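(* Let $\Lambda$ be a ring, let $\mathbf{C}:\cdots\to C_{n+1}\xrightarrow{d_{n+1}}C_n\xrightarrow{d_n}C_{n-1}\to\cdots$ be a complex of projective left $\Lambda$-modules, and let $n$ be an integer. Write $H^n(\mathbf{C},-)$ for the functor $M\mapsto H^n(\mathrm{Hom}_\Lambda(\mathbf{C},M))$ from left $\Lambda$-modules to abelian groups. Then the right fundamental sequence of $H^n(\mathbf{C},-)$ is exact and of the form $$0\to\mathrm{Ext}^1(C_{n-1}/B_{n-1},-)\to H^n(\mathbf{C},-)\to(H_n(\mathbf{C}),-)\to\mathrm{Ext}^2(C_{n-1}/B_{n-1},-)\to\mathrm{Ext}^1(C_n/B_n,-)\to\mathrm{Ext}^1(H_n(\mathbf{C}),-)\to\mathrm{Ext}^3(C_{n-1}/B_{n-1},-)\to\mathrm{Ext}^2(C_n/B_n,-)\to\mathrm{Ext}^2(H_n(\mathbf{C}),-)\to\mathrm{Ext}^4(C_{n-1}/B_{n-1},-)\to\mathrm{Ext}^3(C_n/B_n,-)\to\cdots,$$ i.e., with $F=H^n(\mathbf{C},-)$, its terms are identified via natural isomorphisms $\overline{F}\circ\Sigma^i\simeq\mathrm{Ext}^{i+1}_\Lambda(C_{n-1}/B_{n-1},-)$ and $R^iF\simeq\mathrm{Ext}^i_\Lambda(H_n(\mathbf{C}),-)$ for $i\ge0$, and $S^iF\simeq\mathrm{Ext}^i_\Lambda(C_n/B_n,-)$ for $i\ge1$.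
   Context: $(A,-)$ denotes $\mathrm{Hom}_\Lambda(A,-)$, and $B_k=\mathrm{Im}\,d_{k+1}$ denotes the boundaries of $\mathbf{C}$. Right fundamental sequence of an additive covariant functor $F$ from left $\Lambda$-modules to abelian groups. For a module $B$ choose an injective resolution $0\to B\to I^0\xrightarrow{d^0}I^1\xrightarrow{d^1}\cdots$. Put $\Sigma^0B=B$, let $m_0:B\to I^0$ be the given embedding, and for $i\ge0$ let $e_i:I^i\to\Sigma^{i+1}B$ be the cokernel of $m_i:\Sigma^iB\to I^i$ and $m_{i+1}:\Sigma^{i+1}B\to I^{i+1}$ the monomorphism with $d^i=m_{i+1}e_i$. Define $R^iF(B)=\mathrm{Ker}\,F(d^i)/\mathrm{Im}\,F(d^{i-1})$ (with $\mathrm{Im}\,F(d^{-1}):=0$); the sub-stabilization $\overline{F}(B)=\mathrm{Ker}(F(m_0):F(B)\to F(I^0))$, so that $(\overline{F}\circ\Sigma^i)(B)=\overline{F}(\Sigma^iB)=\mathrm{Ker}\,F(m_i)$ (well defined since $\overline{F}$ vanishes on injectives); the right satellites $S^0F=F$ and $S^iF(B)=\mathrm{Coker}(F(e_{i-1}):F(I^{i-1})\to F(\Sigma^iB))$ for $i\ge1$. The right fundamental sequence of $F$ is the sequence of functors $$0\to\overline{F}\to F\to R^0F\to\overline{F}\circ\Sigma\to S^1F\to R^1F\to\overline{F}\circ\Sigma^2\to S^2F\to R^2F\to\cdots$$ with maps, for $i\ge0$: $\overline{F}(\Sigma^iB)\to S^iF(B)$ the inclusion into $F(\Sigma^iB)$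 followed by the projection; $S^iF(B)\to R^iF(B)$ induced by $F(m_i):F(\Sigma^iB)\to\mathrm{Ker}\,F(d^i)$; $R^iF(B)\to\overline{F}(\Sigma^{i+1}B)$ induced by $F(e_i)$. *)

(* Defs.v *)
From HB Require Import structures.
From mathcomp Require Import all_boot all_algebra boolp.

Set Implicit Arguments.
Unset Strict Implicit.
Unset Printing Implicit Defensive.

Import GRing.Theory.
Local Open Scope ring_scope.
Local Open Scope quotient_scope.

Section HomGroup.
Variables (L : pzRingType) (A B : lmodType L).

Lemma linear_ext (f g : {linear A -> B}) : (forall x, f x = g x) -> f = g.
Proof.
move=> /funext; case: f => f [[a] [b]]; case: g => g [[a'] [b']] /= E.
move: E a b a' b' => -> a b a' b'.
congr GRing.Linear.Pack; congr GRing.Linear.Class.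
  by congr GRing.isNmodMorphism.Axioms_; exact: Prop_irrelevance.
by congr GRing.isScalable.Axioms_; exact: Prop_irrelevance.
Qed.

HB.instance Definition _ := gen_eqMixin {linear A -> B}.
HB.instance Definition _ := gen_choiceMixin {linear A -> B}.

Definition lin_zero : {linear A -> B} := \0.
Definition lin_opp (f : {linear A -> B}) : {linear A -> B} := \- f.
Definition lin_add (f g : {linear A -> B}) : {linear A -> B} := f \+ g.

Lemma lin_addA : associative lin_add.
Proof. by move=> f g h; apply: linear_ext => x /=; rewrite addrA. Qed.
Lemma lin_addC : commutative lin_add.
Proof. by move=> f g; apply: linear_ext => x /=; rewrite addrC. Qed.
Lemma lin_add0 : left_id lin_zero lin_add.
Proof. by move=> f; apply: linear_ext => x /=; rewrite add0r. Qed.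
Lemma lin_addN : left_inverse lin_zero lin_opp lin_add.
Proof. by move=> f; apply: linear_ext => x /=; rewrite addNr. Qed.

HB.instance Definition _ :=
  GRing.isZmodule.Build {linear A -> B} lin_addA lin_addC lin_add0 lin_addN.

End HomGroup.


(* SubmodClosed does not inherit from ZmodClosed, hence this bundling. *)
Record submodule (L : pzRingType) (V : lmodType L) := Submodule {
  submod_zmod :> zmodClosed V;
  submodZ : GRing.scaler_closed submod_zmod
}.

Section ZSub.
Variables (V : zmodType) (K : zmodClosed V).

Record zsub := ZSub { zval : V; zvalP : zval \in K }.
HB.instance Definition _ := [isSub for zval].
HB.instance Definition _ := [Choice of zsub by <:].
HB.instance Definition _ := [SubChoice_isSubZmodule of zsub by <:].

Definition zincl : {additive zsub -> V} := val.

Variables (W : zmodType) (f : {additive W -> V}) (fK : forall w, f w \in K).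
Definition zcorestr_fun (w : W) : zsub := ZSub (fK w).
Lemma zcorestr_is_additive : zmod_morphism zcorestr_fun.
Proof. by move=> x y; apply: val_inj; rewrite /= !raddfB. Qed.
HB.instance Definition _ :=
  GRing.isZmodMorphism.Build W zsub zcorestr_fun zcorestr_is_additive.
Definition zcorestr : {additive W -> zsub} := zcorestr_fun.
End ZSub.

Section LSub.
Variables (L : pzRingType) (V : lmodType L) (K : submodule V).

Definition lsub := zsub K.
HB.instance Definition _ := SubType.on lsub.
HB.instance Definition _ := GRing.SubZmodule.on lsub.
Lemma lsub_closed : GRing.subsemimod_closed (K : zmodClosed V).
Proof.
by split; [split; [exact: rpred0 | exact: rpredD] | exact: submodZ].
Qed.
HB.instance Definition _ :=
  GRing.SubZmodule_isSubLmodule.Build L V _ lsub lsub_closed.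

Definition lincl : {linear lsub -> V} := val.
End LSub.

Section ZQuot.
Variables (V : zmodType) (N : zmodClosed V).

Definition zquot := {ideal_quot N}.
HB.instance Definition _ := GRing.Zmodule.on zquot.

Definition zpi_fun : V -> zquot := \pi_{ideal_quot N}.
Lemma zpi_is_additive : zmod_morphism zpi_fun.
Proof. by move=> x y; rewrite /zpi_fun raddfB. Qed.
HB.instance Definition _ :=
  GRing.isZmodMorphism.Build V zquot zpi_fun zpi_is_additive.
Definition zpi : {additive V -> zquot} := zpi_fun.

Lemma zpi_surj (q : zquot) : exists x, zpi x = q.
Proof. by exists (repr (q : {ideal_quot N})); exact: reprK. Qed.

Lemma zpi_eq (x y : V) : zpi x = zpi y <-> x - y \in N.
Proof. by rewrite Quotient.idealrBE; split=> [/eqP|/eqP]. Qed.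

Lemma zpi_eq0 (x : V) : zpi x = 0 <-> x \in N.
Proof. by rewrite -(raddf0 zpi) zpi_eq subr0. Qed.

Variables (W : zmodType) (f : {additive V -> W}).
Hypothesis fN : forall x, x \in N -> f x = 0.

Definition zdesc_fun of (forall x, x \in N -> f x = 0) :=
  fun q : zquot => f (repr (q : {ideal_quot N})).

Lemma zdesc_funE (x : V) : zdesc_fun fN (zpi x) = f x.
Proof.
apply/eqP; rewrite -subr_eq0 -raddfB; apply/eqP/fN/zpi_eq.
exact: reprK.
Qed.

Lemma zdesc_is_additive : zmod_morphism (zdesc_fun fN).
Proof.
move=> p q; case: (zpi_surj p) => x <-; case: (zpi_surj q) => y <-.
by rewrite -raddfB !zdesc_funE raddfB.
Qed.
HB.instance Definition _ :=
  GRing.isZmodMorphism.Build zquot W (zdesc_fun fN) zdesc_is_additive.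
Definition zdesc : {additive zquot -> W} := zdesc_fun fN.

Lemma zdescE (x : V) : zdesc (zpi x) = f x.
Proof. exact: zdesc_funE. Qed.
End ZQuot.

Section LQuot.
Variables (L : pzRingType) (V : lmodType L) (N : submodule V).

Definition lquot := zquot N.
HB.instance Definition _ := GRing.Zmodule.on lquot.

Definition lquot_scale (a : L) (q : lquot) : lquot :=
  zpi N (a *: repr (q : {ideal_quot N})).

Lemma lquot_scaleE a x : lquot_scale a (zpi N x) = zpi N (a *: x).
Proof.
apply/zpi_eq; rewrite -scalerBr; apply: submodZ; apply/zpi_eq; exact: reprK.
Qed.

Lemma lquot_scaleA a b v : lquot_scale a (lquot_scale b v) = lquot_scale (a * b) v.
Proof. by case: (zpi_surj v) => x <-; rewrite !lquot_scaleE scalerA. Qed.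
Lemma lquot_scale1 : left_id 1 lquot_scale.
Proof. by move=> v; case: (zpi_surj v) => x <-; rewrite lquot_scaleE scale1r. Qed.
Lemma lquot_scaleDr : right_distributive lquot_scale +%R.
Proof.
move=> a u v; case: (zpi_surj u) => x <-; case: (zpi_surj v) => y <-.
by rewrite -raddfD !lquot_scaleE -raddfD scalerDr.
Qed.
Lemma lquot_scaleDl v : {morph lquot_scale^~ v : a b / a + b}.
Proof.
move=> a b; case: (zpi_surj v) => x <-.
by rewrite !lquot_scaleE -raddfD scalerDl.
Qed.
HB.instance Definition _ := GRing.Zmodule_isLmodule.Build L lquot
  lquot_scaleA lquot_scale1 lquot_scaleDr lquot_scaleDl.

Definition lpi_fun : V -> lquot := zpi N.
Lemma lpi_is_linear : linear lpi_fun.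
Proof.
by move=> a x y; rewrite /lpi_fun raddfD /= -lquot_scaleE.
Qed.
HB.instance Definition _ := GRing.isLinear.Build L V lquot _ lpi_fun lpi_is_linear.
Definition lpi : {linear V -> lquot} := lpi_fun.

Lemma lpi_surj (q : lquot) : exists x, lpi x = q.
Proof. exact: zpi_surj. Qed.

Lemma lpi_eq0 (x : V) : lpi x = 0 <-> x \in N.
Proof. exact: zpi_eq0. Qed.

Variables (W : lmodType L) (f : {linear V -> W}).
Hypothesis fN : forall x, x \in N -> f x = 0.

Definition ldesc_fun : lquot -> W := zdesc fN.
Lemma ldesc_is_linear : linear ldesc_fun.
Proof.
move=> a p q; case: (lpi_surj p) => x <-; case: (lpi_surj q) => y <-.
by rewrite -linearP /ldesc_fun !zdescE; exact: linearP.
Qed.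
HB.instance Definition _ := GRing.isLinear.Build L lquot W _ ldesc_fun ldesc_is_linear.
Definition ldesc : {linear lquot -> W} := ldesc_fun.

Lemma ldescE (x : V) : ldesc (lpi x) = f x.
Proof. exact: zdescE. Qed.
End LQuot.


Section KerIm.
Variables (U V : zmodType).

Definition kerp (f : U -> V) : U -> bool := fun x => f x == 0.
Definition imp (f : U -> V) : V -> bool := fun y => `[< exists x, f x = y >].
Definition nullp : U -> bool := fun x => x == 0.

Lemma kerpP f x : reflect (f x = 0) (x \in kerp f).
Proof. exact: eqP. Qed.
Lemma impP f y : reflect (exists x, f x = y) (y \in imp f).
Proof. exact: asboolP. Qed.
Lemma nullpP x : reflect (x = 0) (x \in nullp).
Proof. exact: eqP. Qed.

Variable f : {additive U -> V}.
Lemma kerp_zmod : zmod_closed (kerp f).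
Proof.
split=> [|x y /kerpP fx /kerpP fy]; apply/kerpP; first exact: raddf0.
by rewrite raddfB fx fy subr0.
Qed.
HB.instance Definition _ := GRing.isZmodClosed.Build U (kerp f) kerp_zmod.

Lemma imp_zmod : zmod_closed (imp f).
Proof.
split=> [|x y /impP[a <-] /impP[b <-]]; apply/impP.
  by exists 0; rewrite raddf0.
by exists (a - b); rewrite raddfB.
Qed.
HB.instance Definition _ := GRing.isZmodClosed.Build V (imp f) imp_zmod.

Lemma nullp_zmod : zmod_closed nullp.
Proof.
by split=> [|x y /nullpP -> /nullpP ->]; apply/nullpP; rewrite ?subr0.
Qed.
HB.instance Definition _ := GRing.isZmodClosed.Build U nullp nullp_zmod.

Definition zker : zmodClosed U := GRing.ZmodClosed.clone U (kerp f) _.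
Definition zim : zmodClosed V := GRing.ZmodClosed.clone V (imp f) _.
Definition zzero : zmodClosed U := GRing.ZmodClosed.clone U nullp _.

End KerIm.

Section KerImL.
Variables (L : pzRingType) (U V : lmodType L) (f : {linear U -> V}).
Lemma kerp_scale : GRing.scaler_closed (zker f).
Proof.
move=> a x /kerpP fx; apply/kerpP; change (f (a *: x) = 0).
by rewrite linearZ /= [X in _ *: X]fx scaler0.
Qed.
Lemma imp_scale : GRing.scaler_closed (zim f).
Proof.
by move=> a y /impP[x <-]; apply/impP; exists (a *: x); exact: linearZ.
Qed.
Definition lker : submodule U := Submodule kerp_scale.
Definition lim : submodule V := Submodule imp_scale.
End KerImL.


(* zsubquot K N is K / (K :&: N): no proof that N lies in K is required, and it
   is the usual subquotient K / N when it does. *)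
Section ZSubQuot.
Variable V : zmodType.

Definition restrp (K N : zmodClosed V) : zsub K -> bool := fun x => val x \in N.
Lemma restrp_zmod K N : zmod_closed (@restrp K N).
Proof.
split=> [|x y xN yN]; rewrite unfold_in /restrp ?rpred0 //.
exact: (rpredB xN yN).
Qed.
HB.instance Definition _ K N :=
  GRing.isZmodClosed.Build (zsub K) (@restrp K N) (restrp_zmod K N).
Definition zrestr (K N : zmodClosed V) : zmodClosed (zsub K) :=
  GRing.ZmodClosed.clone (zsub K) (@restrp K N) _.

Definition zsubquot (K N : zmodClosed V) : zmodType := zquot (zrestr K N).
Definition zcls (K N : zmodClosed V) : {additive zsub K -> zsubquot K N} :=
  zpi (zrestr K N).

Lemma zcls_eq (K N : zmodClosed V) (x y : zsub K) :
  zcls K N x = zcls K N y <-> val x - val y \in N.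
Proof. exact: zpi_eq. Qed.

Lemma zcls_eq0 (K N : zmodClosed V) (x : zsub K) :
  zcls K N x = 0 <-> val x \in N.
Proof. exact: zpi_eq0. Qed.

Lemma zcls_surj (K N : zmodClosed V) (q : zsubquot K N) : exists x, zcls K N x = q.
Proof. exact: zpi_surj. Qed.

End ZSubQuot.

Section LSubQuot.
Variables (L : pzRingType) (V : lmodType L) (K N : submodule V).
Lemma lrestr_scale :
  GRing.scaler_closed (zrestr K N : zmodClosed (lsub K)).
Proof.
move=> a x xN; change (val (a *: x) \in (N : zmodClosed V)).
have -> : val (a *: x) = a *: val x by exact: (linearZ_LR (lincl K) a x).
by apply: submodZ; exact: xN.
Qed.
Definition lrestr : submodule (lsub K) := Submodule lrestr_scale.
Definition lsubquot : lmodType L := lquot lrestr.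
End LSubQuot.

Section ZMaps.
Variables (V V' : zmodType) (f : {additive V -> V'}).

Lemma zsub_map_subproof (K : zmodClosed V) (K' : zmodClosed V') :
  (forall x, x \in K -> f x \in K') ->
  forall x : zsub K, (f \o val) x \in K'.
Proof. by move=> fK x; apply: fK; exact: valP. Qed.
Definition zsub_map (K : zmodClosed V) (K' : zmodClosed V')
    (fK : forall x, x \in K -> f x \in K') : {additive zsub K -> zsub K'} :=
  zcorestr (zsub_map_subproof fK).

Lemma zquot_map_subproof (N : zmodClosed V) (N' : zmodClosed V') :
  (forall x, x \in N -> f x \in N') ->
  forall x, x \in N -> (zpi N' \o f) x = 0.
Proof. by move=> fN x /fN xN; apply/zpi_eq0. Qed.
Definition zquot_map (N : zmodClosed V) (N' : zmodClosed V')
    (fN : forall x, x \in N -> f x \in N') : {additive zquot N -> zquot N'} :=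
  zdesc (zquot_map_subproof fN).

Lemma zsubquot_map_subproof (K N : zmodClosed V) (K' N' : zmodClosed V')
    (fK : forall x, x \in K -> f x \in K') :
  (forall x, x \in N -> f x \in N') ->
  forall x, x \in zrestr K N -> (zcls K' N' \o zsub_map fK) x = 0.
Proof. by move=> fN x xN; apply/zcls_eq0; apply: fN; exact: xN. Qed.
Definition zsubquot_map (K N : zmodClosed V) (K' N' : zmodClosed V')
    (fK : forall x, x \in K -> f x \in K') (fN : forall x, x \in N -> f x \in N') :
    {additive zsubquot K N -> zsubquot K' N'} :=
  zdesc (zsubquot_map_subproof fK fN).

Lemma zsubquot_mapE (K N : zmodClosed V) (K' N' : zmodClosed V')
    (fK : forall x, x \in K -> f x \in K') (fN : forall x, x \in N -> f x \in N') x :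
  zsubquot_map fK fN (zcls K N x) = zcls K' N' (zsub_map fK x).
Proof. exact: zdescE. Qed.
End ZMaps.

(* Additive covariant functors from left L-modules to abelian groups. *)
Record addFunctor (L : pzRingType) := AddFunctor {
  fobj :> lmodType L -> zmodType;
  fmap : forall A B : lmodType L, {linear A -> B} -> {additive fobj A -> fobj B};
  fmap_id : forall (A : lmodType L) x, fmap (idfun : {linear A -> A}) x = x;
  fmap_comp : forall (A B C : lmodType L) (g : {linear B -> C})
      (f : {linear A -> B}) x,
    fmap (g \o f : {linear A -> C}) x = fmap g (fmap f x);
  fmap_add : forall (A B : lmodType L) (f g : {linear A -> B}) x,
    fmap (f + g) x = fmap f x + fmap g x
}.

Record natTrans (L : pzRingType) (F G : addFunctor L) := NatTrans {
  component :> forall M : lmodType L, {additive F M -> G M};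
  naturality : forall (M N : lmodType L) (f : {linear M -> N}) x,
    component N (fmap F f x) = fmap G f (component M x)
}.

Definition naturally_isomorphic (L : pzRingType) (F G : addFunctor L) : Prop :=
  exists eta : natTrans F G, forall M, bijective (eta M).

Definition exact_at (A B C : zmodType) (f : A -> B) (g : B -> C) : Prop :=
  forall y, g y = 0 <-> exists x, f x = y.

Section FunctorTheory.
Variables (L : pzRingType) (F : addFunctor L).

Lemma fmap_compE (A B C : lmodType L) (g : {linear B -> C})
    (f : {linear A -> B}) (h : {linear A -> C}) x :
  (forall a, g (f a) = h a) -> fmap F g (fmap F f x) = fmap F h x.
Proof.
move=> gf; rewrite -fmap_comp; congr (fmap F _ x).
exact: linear_ext.
Qed.

Lemma fmap_sq (A B B' C : lmodType L) (g : {linear B -> C})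
    (f : {linear A -> B}) (g' : {linear B' -> C}) (f' : {linear A -> B'}) x :
  (forall a, g (f a) = g' (f' a)) ->
  fmap F g (fmap F f x) = fmap F g' (fmap F f' x).
Proof. by move=> sq; rewrite -[RHS]fmap_comp; apply: fmap_compE. Qed.

Lemma fmap0 (A B : lmodType L) x : fmap F (0 : {linear A -> B}) x = 0.
Proof.
apply: (@addrI _ (fmap F (0 : {linear A -> B}) x)).
by rewrite -fmap_add !addr0.
Qed.

Lemma fmapB (A B : lmodType L) (f g : {linear A -> B}) x :
  fmap F (f - g) x = fmap F f x - fmap F g x.
Proof. by apply: (@addIr _ (fmap F g x)); rewrite -fmap_add !subrK. Qed.

Lemma fmap_zero (A B C : lmodType L) (g : {linear B -> C})
    (f : {linear A -> B}) x :
  (forall a, g (f a) = 0) -> fmap F g (fmap F f x) = 0.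
Proof. by move=> gf; rewrite (@fmap_compE _ _ _ _ _ 0) ?fmap0. Qed.

End FunctorTheory.

Section HomFunctor.
Variables (L : pzRingType).

Section Post.
Variables (A M N : lmodType L) (g : {linear M -> N}).
Definition postcomp_fun (f : {linear A -> M}) : {linear A -> N} := g \o f.
Lemma postcomp_additive : zmod_morphism postcomp_fun.
Proof. by move=> f h; apply: linear_ext => x; exact: raddfB. Qed.
HB.instance Definition _ := GRing.isZmodMorphism.Build
  {linear A -> M} {linear A -> N} postcomp_fun postcomp_additive.
Definition postcomp : {additive {linear A -> M} -> {linear A -> N}} := postcomp_fun.
End Post.

Section Pre.
Variables (A B M : lmodType L) (g : {linear A -> B}).
Definition precomp_fun (f : {linear B -> M}) : {linear A -> M} := f \o g.
Lemma precomp_additive : zmod_morphism precomp_fun.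
Proof. by move=> f h; apply: linear_ext => x. Qed.
HB.instance Definition _ := GRing.isZmodMorphism.Build
  {linear B -> M} {linear A -> M} precomp_fun precomp_additive.
Definition precomp : {additive {linear B -> M} -> {linear A -> M}} := precomp_fun.
End Pre.

Variable A : lmodType L.

Lemma postcomp_id (M : lmodType L) (f : {linear A -> M}) :
  postcomp A (idfun : {linear M -> M}) f = f.
Proof. exact: linear_ext. Qed.
Lemma postcomp_comp (M N P : lmodType L) (g : {linear N -> P})
    (f : {linear M -> N}) (h : {linear A -> M}) :
  postcomp A (g \o f : {linear M -> P}) h = postcomp A g (postcomp A f h).
Proof. exact: linear_ext. Qed.
Lemma postcomp_add (M N : lmodType L) (f g : {linear M -> N}) (h : {linear A -> M}) :
  postcomp A (f + g) h = postcomp A f h + postcomp A g h.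
Proof. exact: linear_ext. Qed.

Definition homF : addFunctor L :=
  @AddFunctor L (fun M => {linear A -> M}) (@postcomp A)
    postcomp_id postcomp_comp postcomp_add.
End HomFunctor.

(* The boundary map is indexed by both its source and its target degree, so that
   no transport along n - 1 + 1 = n is needed; d_n is bdry n (n - 1), and the
   components that do not lower the degree by exactly one vanish. *)
Record chain_complex (L : pzRingType) := ChainComplex {
  chain :> int -> lmodType L;
  bdry : forall i j : int, {linear chain i -> chain j};
  bdry_shape : forall i j, i != j + 1 -> forall x, bdry i j x = 0;
  bdry_bdry : forall i j k x, bdry j k (bdry i j x) = 0
}.

Section ComplexHomology.
Variables (L : pzRingType) (C : chain_complex L) (n : int).

(* H_n(C), with the left module structure *)
Definition homology : lmodType L :=
  lsubquot (lker (bdry C n (n - 1))) (lim (bdry C (n + 1) n)).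

(* C_n / B_n, where B_n = Im d_(n+1) *)
Definition chain_mod_bdry : lmodType L := lquot (lim (bdry C (n + 1) n)).

(* H^n(C, M) is the cohomology at Hom(C_n, M) of
   Hom(C_(n-1), M) -> Hom(C_n, M) -> Hom(C_(n+1), M). *)
Definition cocycles (M : lmodType L) : zmodClosed {linear C n -> M} :=
  zker (precomp M (bdry C (n + 1) n)).
Definition cobdries (M : lmodType L) : zmodClosed {linear C n -> M} :=
  zim (precomp M (bdry C n (n - 1))).

Section Map.
Variables (M N : lmodType L) (g : {linear M -> N}).
Lemma cocycles_map f : f \in cocycles M -> postcomp (C n) g f \in cocycles N.
Proof.
move=> /kerpP /= fZ; apply/kerpP; apply: linear_ext => x /=.
have /(congr1 (fun h : {linear _ -> _} => h x)) /= -> := fZ.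
exact: raddf0.
Qed.
Lemma cobdries_map f : f \in cobdries M -> postcomp (C n) g f \in cobdries N.
Proof.
move=> /impP[h <-]; apply/impP; exists (postcomp _ g h).
exact: linear_ext.
Qed.
End Map.


Definition cohom_obj (M : lmodType L) : zmodType :=
  zsubquot (cocycles M) (cobdries M).
Definition cohom_map (M N : lmodType L) (g : {linear M -> N}) :
    {additive cohom_obj M -> cohom_obj N} :=
  zsubquot_map (@cocycles_map M N g) (@cobdries_map M N g).

Lemma cohom_mapE (M N : lmodType L) (g : {linear M -> N}) (y : zsub (cocycles M)) :
  cohom_map g (zcls _ _ y) = zcls _ _ (zsub_map (@cocycles_map M N g) y).
Proof. exact: zsubquot_mapE. Qed.

Lemma cohom_id (M : lmodType L) x : cohom_map (idfun : {linear M -> M}) x = x.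
Proof.
case: (zcls_surj x) => y <-; rewrite cohom_mapE; congr (zcls _ _ _).
by apply: val_inj; exact: postcomp_id.
Qed.
Lemma cohom_comp (M N P : lmodType L) (g : {linear N -> P})
    (f : {linear M -> N}) x :
  cohom_map (g \o f : {linear M -> P}) x = cohom_map g (cohom_map f x).
Proof.
case: (zcls_surj x) => y <-; rewrite (cohom_mapE f) (cohom_mapE g) cohom_mapE.
by congr (zcls _ _ _); apply: val_inj; exact: postcomp_comp.
Qed.
Lemma cohom_add (M N : lmodType L) (f g : {linear M -> N}) x :
  cohom_map (f + g) x = cohom_map f x + cohom_map g x.
Proof.
case: (zcls_surj x) => y <-; rewrite (cohom_mapE f) (cohom_mapE g) cohom_mapE.
rewrite -raddfD; congr (zcls _ _ _); apply: val_inj; exact: postcomp_add.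
Qed.

Definition cohomology : addFunctor L :=
  AddFunctor cohom_id cohom_comp cohom_add.
End ComplexHomology.

Definition injective_module (L : pzRingType) (E : lmodType L) : Prop :=
  forall (A B : lmodType L) (m : {linear A -> B}) (f : {linear A -> E}),
    injective m -> exists g : {linear B -> E}, forall a, g (m a) = f a.

Definition projective_module (L : pzRingType) (P : lmodType L) : Prop :=
  forall (A B : lmodType L) (e : {linear A -> B}) (f : {linear P -> B}),
    (forall b, exists a, e a = b) ->
    exists g : {linear P -> A}, forall p, e (g p) = f p.

(* 0 -> B -> res 0 -> res 1 -> ... exact with every res i injective *)
Record injective_resolution (L : pzRingType) (B : lmodType L) := InjRes {
  res :> nat -> lmodType L;
  res_inj : forall i, injective_module (res i);
  aug : {linear B -> res 0};
  diff : forall i, {linear res i -> res i.+1};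
  aug_inj : injective aug;
  aug_exact : exact_at aug (diff 0);
  diff_exact : forall i, exact_at (diff i) (diff i.+1)
}.
Arguments aug {L B}.
Arguments diff {L B} _ i.
Arguments res_inj {L B} _ i.
Arguments aug_inj {L B} _.
Arguments aug_exact {L B} _.
Arguments diff_exact {L B} _ i.

Section Cosyzygies.
Variables (L : pzRingType) (B : lmodType L) (E : injective_resolution B).

(* Im m_i inside E i, where m_i = cosyz_mono i below. It is written as the image
   of the incoming map of the resolution (d^(i-1), or the augmentation for
   i = 0), which is the same submodule: see cosyz_exact. *)
Definition prev_image (i : nat) : submodule (E i) :=
  match i return submodule (E i) with
  | 0 => lim (aug E)
  | j.+1 => lim (diff E j)
  end.

Lemma prev_imageE i x : x \in (prev_image i : zmodClosed _) <-> diff E i x = 0.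
Proof.
case: i x => [|i] x; split.
- by move/impP => ex; apply: (aug_exact E x).2.
- by move/(aug_exact E x).1 => ex; apply/impP.
- by move/impP => ex; apply: (diff_exact E i x).2.
- by move/(diff_exact E i x).1 => ex; apply/impP.
Qed.

Lemma prev_image_diff i x : x \in (prev_image i : zmodClosed _) -> diff E i x = 0.
Proof. by move/prev_imageE. Qed.

(* Sigma^i B, with e_i = cosyz_epi i the cokernel of m_i = cosyz_mono i and
   d^i = m_(i+1) e_i (cosyz_diff). *)
Definition cosyz (i : nat) : lmodType L :=
  match i with 0 => B | j.+1 => lquot (prev_image j) end.

Definition cosyz_epi (i : nat) : {linear E i -> cosyz i.+1} := lpi (prev_image i).

Definition cosyz_mono (i : nat) : {linear cosyz i -> E i} :=
  match i return {linear cosyz i -> E i} with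
  | 0 => aug E
  | j.+1 => ldesc (@prev_image_diff j)
  end.

Lemma cosyz_diff i x : diff E i x = cosyz_mono i.+1 (cosyz_epi i x).
Proof. exact/esym/ldescE. Qed.

Lemma cosyz_epi_surj i q : exists x, cosyz_epi i x = q.
Proof. exact: lpi_surj. Qed.

Lemma cosyz_mono_inj i : injective (cosyz_mono i).
Proof.
case: i => [|i]; first exact: aug_inj.
move=> p q; case: (cosyz_epi_surj p) => x <-; case: (cosyz_epi_surj q) => y <-.
rewrite -!cosyz_diff => xy; apply/zpi_eq/prev_imageE.
by rewrite linearB; apply/eqP; rewrite subr_eq0; apply/eqP.
Qed.

Lemma cosyz_exact i : exact_at (cosyz_mono i) (cosyz_epi i).
Proof.
move=> x; split.
  move/lpi_eq0; case: i x => [|i] x; move/impP => [y <-]; first by exists y.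
  by exists (cosyz_epi i y); rewrite -cosyz_diff.
case=> y <- {x}; apply/lpi_eq0/prev_imageE.
case: i y => [|i] y; first by apply: (aug_exact E _).2; exists y.
case: (cosyz_epi_surj y) => z <-; rewrite -cosyz_diff.
by apply: (diff_exact E _ _).2; exists z.
Qed.

Lemma cosyz_mono_epi i s : cosyz_epi i (cosyz_mono i s) = 0.
Proof. by apply: (cosyz_exact _).2; exists s. Qed.

End Cosyzygies.

Section Lifting.
Variables (L : pzRingType).
Variables (B B' : lmodType L).
Variables (E : injective_resolution B) (E' : injective_resolution B').

Lemma ext_subproof i (s : {linear cosyz E i -> cosyz E' i}) :
  exists phi : {linear E i -> E' i},
    forall x, phi (cosyz_mono E i x) = cosyz_mono E' i (s x).
Proof.
exact: (res_inj E' i _ _ (cosyz_mono E i) (cosyz_mono E' i \o s) (@cosyz_mono_inj _ _ E i)).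
Qed.

(* Action on morphisms: f : B -> B' is lifted to the resolutions by a choice of
   extension at each stage. lift_ker_eq, lift_coker_eq and lift_der_eq show that
   the maps induced on the functors below do not depend on the choices. *)
Definition ext i (s : {linear cosyz E i -> cosyz E' i}) : {linear E i -> E' i} :=
  projT1 (cid (ext_subproof s)).

Lemma extE i (s : {linear cosyz E i -> cosyz E' i}) x :
  ext s (cosyz_mono E i x) = cosyz_mono E' i (s x).
Proof. exact: (projT2 (cid (ext_subproof s))). Qed.

Lemma cosyz_next_subproof i (s : {linear cosyz E i -> cosyz E' i}) x :
  x \in (prev_image E i : zmodClosed _) -> (cosyz_epi E' i \o ext s) x = 0.
Proof.
by move=> /lpi_eq0/(cosyz_exact _).1[y <-] /=; rewrite extE cosyz_mono_epi.
Qed.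

Definition cosyz_next i (s : {linear cosyz E i -> cosyz E' i}) :
    {linear cosyz E i.+1 -> cosyz E' i.+1} :=
  ldesc (cosyz_next_subproof s).

Lemma cosyz_nextE i (s : {linear cosyz E i -> cosyz E' i}) x :
  cosyz_next s (cosyz_epi E i x) = cosyz_epi E' i (ext s x).
Proof. exact: ldescE. Qed.

Variable f : {linear B -> B'}.

Fixpoint cosyz_map (i : nat) : {linear cosyz E i -> cosyz E' i} :=
  match i return {linear cosyz E i -> cosyz E' i} with
  | 0 => f
  | j.+1 => cosyz_next (cosyz_map j)
  end.

Definition res_map (i : nat) : {linear E i -> E' i} := ext (cosyz_map i).

Lemma res_map_mono i x :
  res_map i (cosyz_mono E i x) = cosyz_mono E' i (cosyz_map i x).
Proof. exact: extE. Qed.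

Lemma cosyz_map_epi i x :
  cosyz_map i.+1 (cosyz_epi E i x) = cosyz_epi E' i (res_map i x).
Proof. exact: cosyz_nextE. Qed.

Lemma res_map_diff i x : res_map i.+1 (diff E i x) = diff E' i (res_map i x).
Proof. by rewrite !cosyz_diff res_map_mono cosyz_map_epi. Qed.

Fixpoint is_lift (i : nat) : {linear cosyz E i -> cosyz E' i} -> Prop :=
  match i return {linear cosyz E i -> cosyz E' i} -> Prop with
  | 0 => fun s => forall x, s x = f x
  | j.+1 => fun t => exists (s : {linear cosyz E j -> cosyz E' j})
        (phi : {linear E j -> E' j}), [/\ is_lift (i := j) s,
      forall x, phi (cosyz_mono E j x) = cosyz_mono E' j (s x) &
      forall x, t (cosyz_epi E j x) = cosyz_epi E' j (phi x)]
  end.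

Lemma cosyz_map_lift i : is_lift (cosyz_map i).
Proof.
elim: i => [|i IHi] //=; exists (cosyz_map i), (res_map i); split=> // x.
  exact: res_map_mono.
exact: cosyz_map_epi.
Qed.

End Lifting.

Section Null.
Variables (L : pzRingType) (B B' : lmodType L).
Variables (E : injective_resolution B) (E' : injective_resolution B').

Definition null_map i : {linear cosyz E i -> cosyz E' i} -> Prop :=
  match i return {linear cosyz E i -> cosyz E' i} -> Prop with
  | 0 => fun s => forall x, s x = 0
  | j.+1 => fun s => exists h : {linear E j.+1 -> E' j},
      forall x, s x = cosyz_epi E' j (h (cosyz_mono E j.+1 x))
  end.

Definition null_res i : {linear E i -> E' i} -> Prop :=
  match i return {linear E i -> E' i} -> Prop with
  | 0 => fun c => forall x, c x = 0
  | j.+1 => fun c => exists h : {linear E j.+1 -> E' j},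
      forall x, c x = diff E' j (h x)
  end.

Lemma null_step i (s : {linear cosyz E i -> cosyz E' i}) (phi : {linear E i -> E' i}) :
  null_map s -> (forall x, phi (cosyz_mono E i x) = cosyz_mono E' i (s x)) ->
  exists (c : {linear E i -> E' i}) (h : {linear E i.+1 -> E' i}),
    null_res c /\ forall x, phi x = c x + h (diff E i x).
Proof.
move=> s0 phis.
have [c [c0 cphi]] : exists c : {linear E i -> E' i}, null_res c /\
    forall x, phi (cosyz_mono E i x) = c (cosyz_mono E i x).
  case: i s phi s0 phis => [|j] s phi /= s0 phis.
    by exists 0; split=> // x; rewrite phis s0; exact: raddf0.
  case: s0 => h sh; exists (diff E' j \o h); split; first by exists h.
  by move=> x; rewrite phis sh -cosyz_diff.
have psi0 x : x \in (prev_image E i : zmodClosed _) -> (phi - c) x = 0.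
  move=> /lpi_eq0/(cosyz_exact _).1[y <-].
  by rewrite [LHS]/(phi _ - c _) cphi; exact: subrr.
have [h hE] := res_inj E' i _ _ (cosyz_mono E i.+1) (ldesc psi0)
  (@cosyz_mono_inj _ _ E i.+1).
exists c, h; split=> // x; rewrite cosyz_diff hE ldescE.
exact/esym/(@subrKC (E' i)).
Qed.

Lemma null_next i (t : {linear cosyz E i.+1 -> cosyz E' i.+1})
    (c phi : {linear E i -> E' i}) (h : {linear E i.+1 -> E' i}) :
  null_res c -> (forall x, phi x = c x + h (diff E i x)) ->
  (forall x, t (cosyz_epi E i x) = cosyz_epi E' i (phi x)) ->
  null_map t.
Proof.
move=> c0 phiE tE; exists h => q; case: (cosyz_epi_surj q) => x <-.
rewrite tE phiE linearD -cosyz_diff.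
suff -> : cosyz_epi E' i (c x) = 0 by rewrite add0r.
case: i t c phi h c0 phiE tE q x => [|j] t c phi h c0 _ _ _ x.
  by rewrite c0; exact: raddf0.
by case: c0 => g ->; rewrite cosyz_diff cosyz_mono_epi.
Qed.

Lemma lift_null (f : {linear B -> B'}) :
  (forall x, f x = 0) ->
  forall i (s : {linear cosyz E i -> cosyz E' i}), is_lift f s -> null_map s.
Proof.
move=> f0; elim=> [|i IHi] s; first by move=> sf x; rewrite sf.
case=> r [phi [/IHi r0 phir sphi]].
have [c [h [c0 phiE]]] := null_step r0 phir.
exact: null_next c0 phiE sphi.
Qed.

Lemma lift_sub (f g : {linear B -> B'}) i (s t : {linear cosyz E i -> cosyz E' i}) :
  is_lift f s -> is_lift g t -> is_lift (f - g) (s - t).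
Proof.
elim: i s t => [|i IHi] s t; first by move=> /= sf tg x; rewrite -sf -tg.
case=> [r [phi [rL phir sphi]]] [r' [phi' [rL' phir' sphi']]].
exists (r - r'), (phi - phi'); split; first exact: IHi.
- move=> x; rewrite [LHS]/(phi _ - phi' _) phir phir'; exact/esym/(linearB (cosyz_mono E' i)).
- move=> x; rewrite [LHS]/(s _ - t _) sphi sphi'; exact/esym/(linearB (cosyz_epi E' i)).
Qed.

Lemma lift_add (f g : {linear B -> B'}) i (s t : {linear cosyz E i -> cosyz E' i}) :
  is_lift f s -> is_lift g t -> is_lift (f + g) (s + t).
Proof.
elim: i s t => [|i IHi] s t; first by move=> /= sf tg x; rewrite -sf -tg.
case=> [r [phi [rL phir sphi]]] [r' [phi' [rL' phir' sphi']]].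
exists (r + r'), (phi + phi'); split; first exact: IHi.
- move=> x; rewrite [LHS]/(phi _ + phi' _) phir phir'; exact/esym/(linearD (cosyz_mono E' i)).
- move=> x; rewrite [LHS]/(s _ + t _) sphi sphi'; exact/esym/(linearD (cosyz_epi E' i)).
Qed.

Lemma lift_unique (f : {linear B -> B'}) i (s t : {linear cosyz E i -> cosyz E' i}) :
  is_lift f s -> is_lift f t -> null_map (s - t).
Proof.
move=> sf tf; apply: lift_null (lift_sub sf tf) => x.
exact: (subrr (f x)).
Qed.

End Null.

Section LiftComp.
Variables (L : pzRingType) (B B' B'' : lmodType L).
Variables (E : injective_resolution B) (E' : injective_resolution B').
Variables (E'' : injective_resolution B'').

Lemma lift_id i : is_lift (E := E) (E' := E) (idfun : {linear B -> B})
  (idfun : {linear cosyz E i -> cosyz E i}).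
Proof. by elim: i => [|i IHi] //=; exists idfun, idfun. Qed.

Lemma lift_comp (f : {linear B -> B'}) (g : {linear B' -> B''}) i
    (s : {linear cosyz E i -> cosyz E' i}) (t : {linear cosyz E' i -> cosyz E'' i}) :
  is_lift f s -> is_lift g t -> is_lift (g \o f) (t \o s).
Proof.
elim: i s t => [|i IHi] s t; first by move=> sf tg x; rewrite /= sf tg.
case=> [r [phi [rL phir sphi]]] [r' [phi' [rL' phir' sphi']]].
exists (r' \o r), (phi' \o phi); split; first exact: IHi.
- by move=> x; rewrite /= phir phir'.
- by move=> x; rewrite /= sphi sphi'.
Qed.
End LiftComp.

Section DerObjects.
Variables (L : pzRingType) (F : addFunctor L).
Variables (B : lmodType L) (E : injective_resolution B).

Definition der_cocycles (i : nat) : zmodClosed (F (E i)) :=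
  zker (fmap F (diff E i)).

(* Im F(d^(i-1)), with Im F(d^(-1)) := 0 *)
Definition der_cobdries (i : nat) : zmodClosed (F (E i)) :=
  match i return zmodClosed (F (E i)) with
  | 0 => zzero (F (E 0))
  | j.+1 => zim (fmap F (diff E j))
  end.

Definition stab_ker (i : nat) : zmodClosed (F (cosyz E i)) :=
  zker (fmap F (cosyz_mono E i)).

Definition sat_im (j : nat) : zmodClosed (F (cosyz E j.+1)) :=
  zim (fmap F (cosyz_epi E j)).
End DerObjects.

Section LiftFunctor.
Variables (L : pzRingType) (F : addFunctor L) (B B' : lmodType L).
Variables (E : injective_resolution B) (E' : injective_resolution B').

Lemma lift_ker_eq (f : {linear B -> B'}) i (s t : {linear cosyz E i -> cosyz E' i}) x :
  is_lift f s -> is_lift f t -> x \in stab_ker F E i ->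
  fmap F s x = fmap F t x.
Proof.
move=> sf tf /kerpP x0; apply/eqP; rewrite -subr_eq0 -fmapB; apply/eqP.
move: (lift_unique sf tf); move: (s - t) x0 => u {s t sf tf}.
case: i u x => [|j] u x x0 /= u0.
  suff -> : u = 0 by rewrite fmap0.
  exact: linear_ext.
case: u0 => h uE.
rewrite -(fmap_compE (f := cosyz_mono E j.+1) (g := cosyz_epi E' j \o h)) //.
by rewrite x0 raddf0.
Qed.

Lemma lift_coker_eq (f : {linear B -> B'}) j
    (s t : {linear cosyz E j.+1 -> cosyz E' j.+1}) x :
  is_lift f s -> is_lift f t -> fmap F s x - fmap F t x \in sat_im F E' j.
Proof.
move=> sf tf; rewrite -fmapB; case: (lift_unique sf tf) => h uE.
apply/impP; exists (fmap F (h \o cosyz_mono E j.+1) x).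
by apply: fmap_compE => a; rewrite uE.
Qed.

Lemma lift_der_eq (f : {linear B -> B'}) i (s t : {linear cosyz E i -> cosyz E' i})
    (phi psi : {linear E i -> E' i}) x :
  is_lift f s -> is_lift f t ->
  (forall y, phi (cosyz_mono E i y) = cosyz_mono E' i (s y)) ->
  (forall y, psi (cosyz_mono E i y) = cosyz_mono E' i (t y)) ->
  x \in der_cocycles F E i ->
  fmap F phi x - fmap F psi x \in der_cobdries F E' i.
Proof.
move=> sf tf phis psit /kerpP x0; rewrite -fmapB.
have [|c [h [c0 uE]]] := null_step (phi := phi - psi) (lift_unique sf tf).
  move=> y; rewrite [LHS]/(phi _ - psi _) phis psit.
  exact/esym/(linearB (cosyz_mono E' i)).
have -> : phi - psi = c + (h \o diff E i) by exact: linear_ext.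
rewrite fmap_add fmap_comp x0 raddf0 addr0.
case: i c c0 {s t phi psi h uE sf tf phis psit} x x0 => [|j] c c0 x x0.
  suff -> : c = 0 by rewrite fmap0; exact: rpred0.
  exact: linear_ext.
case: c0 => h cE; apply/impP; exists (fmap F h x).
by apply: fmap_compE => a; rewrite cE.
Qed.

Variable f : {linear B -> B'}.

Lemma stab_ker_map i x :
  x \in stab_ker F E i -> fmap F (cosyz_map E E' f i) x \in stab_ker F E' i.
Proof.
move=> /kerpP x0; apply/kerpP.
rewrite (fmap_sq (f' := cosyz_mono E i) (g' := res_map E E' f i)) ?x0 ?raddf0 //.
by move=> a; rewrite res_map_mono.
Qed.

Lemma sat_im_map j x :
  x \in sat_im F E j -> fmap F (cosyz_map E E' f j.+1) x \in sat_im F E' j.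
Proof.
move=> /impP[y <-]; apply/impP; exists (fmap F (res_map E E' f j) y).
by apply: fmap_sq => a; rewrite cosyz_map_epi.
Qed.

Lemma der_cocycles_map i x :
  x \in der_cocycles F E i -> fmap F (res_map E E' f i) x \in der_cocycles F E' i.
Proof.
move=> /kerpP x0; apply/kerpP.
rewrite (fmap_sq (f' := diff E i) (g' := res_map E E' f i.+1)) ?x0 ?raddf0 //.
by move=> a; rewrite res_map_diff.
Qed.

Lemma der_cobdries_map i x :
  x \in der_cobdries F E i -> fmap F (res_map E E' f i) x \in der_cobdries F E' i.
Proof.
case: i x => [|j] x; first by move/nullpP => ->; rewrite raddf0; exact: rpred0.
move=> /impP[y <-]; apply/impP; exists (fmap F (res_map E E' f j) y).
by apply: fmap_sq => a; rewrite res_map_diff.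
Qed.
End LiftFunctor.

Section FundamentalSequence.
Variables (L : pzRingType) (I : forall M : lmodType L, injective_resolution M).
Variable F : addFunctor L.

(* The composite of the sub-stabilization of F with Sigma^i: M |-> Ker F(m_i) *)
Section SubStab.
Variable i : nat.
Definition sub_stab_obj (M : lmodType L) : zmodType := zsub (stab_ker F (I M) i).
Definition sub_stab_map (M N : lmodType L) (f : {linear M -> N}) :
    {additive sub_stab_obj M -> sub_stab_obj N} :=
  zsub_map (@stab_ker_map L F M N (I M) (I N) f i).

Lemma sub_stab_id (M : lmodType L) x : sub_stab_map (idfun : {linear M -> M}) x = x.
Proof.
apply: val_inj; rewrite -[RHS](fmap_id (a := F)).
exact: (lift_ker_eq (cosyz_map_lift _ _ _ _) (lift_id _ _) (valP x)).
Qed.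
Lemma sub_stab_comp (M N P : lmodType L) (g : {linear N -> P}) (f : {linear M -> N}) x :
  sub_stab_map (g \o f : {linear M -> P}) x = sub_stab_map g (sub_stab_map f x).
Proof.
apply: val_inj; rewrite /= -fmap_comp.
apply: (lift_ker_eq (cosyz_map_lift _ _ _ _) _ (valP x)).
exact: lift_comp (cosyz_map_lift _ _ _ _) (cosyz_map_lift _ _ _ _).
Qed.
Lemma sub_stab_add (M N : lmodType L) (f g : {linear M -> N}) x :
  sub_stab_map (f + g) x = sub_stab_map f x + sub_stab_map g x.
Proof.
apply: val_inj; rewrite /= -fmap_add.
apply: (lift_ker_eq (cosyz_map_lift _ _ _ _) _ (valP x)).
exact: lift_add (cosyz_map_lift _ _ _ _) (cosyz_map_lift _ _ _ _).
Qed.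
Definition sub_stab : addFunctor L :=
  AddFunctor sub_stab_id sub_stab_comp sub_stab_add.
End SubStab.

(* satS j is S^(j+1) F *)
Section Satellite.
Variable j : nat.
Definition satS_obj (M : lmodType L) : zmodType := zquot (sat_im F (I M) j).
Definition satS_map (M N : lmodType L) (f : {linear M -> N}) :
    {additive satS_obj M -> satS_obj N} :=
  zquot_map (@sat_im_map L F M N (I M) (I N) f j).

Lemma satS_mapE (M N : lmodType L) (f : {linear M -> N}) y :
  satS_map f (zpi _ y) = zpi _ (fmap F (cosyz_map (I M) (I N) f j.+1) y).
Proof. exact: zdescE. Qed.

Lemma satS_id (M : lmodType L) x : satS_map (idfun : {linear M -> M}) x = x.
Proof.
case: (zpi_surj x) => y <-; rewrite satS_mapE; apply/zpi_eq.
rewrite -[X in _ - X](fmap_id (a := F)).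
exact: lift_coker_eq (cosyz_map_lift _ _ _ _) (lift_id _ _).
Qed.
Lemma satS_comp (M N P : lmodType L) (g : {linear N -> P}) (f : {linear M -> N}) x :
  satS_map (g \o f : {linear M -> P}) x = satS_map g (satS_map f x).
Proof.
case: (zpi_surj x) => y <-; rewrite (satS_mapE f) (satS_mapE g) satS_mapE.
apply/zpi_eq; rewrite -fmap_comp; apply: lift_coker_eq (cosyz_map_lift _ _ _ _) _.
exact: lift_comp (cosyz_map_lift _ _ _ _) (cosyz_map_lift _ _ _ _).
Qed.
Lemma satS_add (M N : lmodType L) (f g : {linear M -> N}) x :
  satS_map (f + g) x = satS_map f x + satS_map g x.
Proof.
case: (zpi_surj x) => y <-; rewrite (satS_mapE f) (satS_mapE g) satS_mapE.
rewrite -raddfD; apply/zpi_eq; rewrite -fmap_add.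
apply: lift_coker_eq (cosyz_map_lift _ _ _ _) _.
exact: lift_add (cosyz_map_lift _ _ _ _) (cosyz_map_lift _ _ _ _).
Qed.
Definition satS : addFunctor L := AddFunctor satS_id satS_comp satS_add.
End Satellite.

Definition satellite (i : nat) : addFunctor L :=
  match i with 0 => F | j.+1 => satS j end.

(* R^i F *)
Section Derived.
Variable i : nat.
Definition derived_obj (M : lmodType L) : zmodType :=
  zsubquot (der_cocycles F (I M) i) (der_cobdries F (I M) i).
Definition derived_map (M N : lmodType L) (f : {linear M -> N}) :
    {additive derived_obj M -> derived_obj N} :=
  zsubquot_map (@der_cocycles_map L F M N (I M) (I N) f i)
    (@der_cobdries_map L F M N (I M) (I N) f i).

Lemma derived_mapE (M N : lmodType L) (f : {linear M -> N}) y :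
  derived_map f (zcls _ _ y) =
  zcls _ _ (zsub_map (@der_cocycles_map L F M N (I M) (I N) f i) y).
Proof. exact: zsubquot_mapE. Qed.

Lemma derived_id (M : lmodType L) x : derived_map (idfun : {linear M -> M}) x = x.
Proof.
case: (zcls_surj x) => y <-; rewrite derived_mapE; apply/zcls_eq.
rewrite -[X in _ - X](fmap_id (a := F)).
apply: lift_der_eq (cosyz_map_lift _ _ _ _) (lift_id _ _) _ _ (valP y) => //.
exact: res_map_mono.
Qed.
Lemma derived_comp (M N P : lmodType L) (g : {linear N -> P}) (f : {linear M -> N}) x :
  derived_map (g \o f : {linear M -> P}) x = derived_map g (derived_map f x).
Proof.
case: (zcls_surj x) => y <-; rewrite (derived_mapE f) (derived_mapE g) derived_mapE.
apply/zcls_eq; rewrite /= -fmap_comp.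
apply: lift_der_eq (cosyz_map_lift _ _ _ _)
  (lift_comp (cosyz_map_lift _ _ _ _) (cosyz_map_lift _ _ _ _)) _ _ (valP y) => z.
  exact: res_map_mono.
by rewrite /= !res_map_mono.
Qed.
Lemma derived_add (M N : lmodType L) (f g : {linear M -> N}) x :
  derived_map (f + g) x = derived_map f x + derived_map g x.
Proof.
case: (zcls_surj x) => y <-; rewrite (derived_mapE f) (derived_mapE g) derived_mapE.
rewrite -raddfD; apply/zcls_eq; rewrite /= -fmap_add.
apply: lift_der_eq (cosyz_map_lift _ _ _ _)
  (lift_add (cosyz_map_lift _ _ _ _) (cosyz_map_lift _ _ _ _)) _ _ (valP y) => z.
  exact: res_map_mono.
rewrite [LHS]/(res_map _ _ _ _ _ + res_map _ _ _ _ _) !res_map_mono.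
exact/esym/(linearD (cosyz_mono _ i)).
Qed.
Definition derived : addFunctor L := AddFunctor derived_id derived_comp derived_add.
End Derived.


Section SeqMaps.
Variables (i : nat) (M : lmodType L).

Definition seq_sub : {additive sub_stab i M -> satellite i M} :=
  match i return {additive sub_stab i M -> satellite i M} with
  | 0 => zincl (stab_ker F (I M) 0)
  | j.+1 => zpi (sat_im F (I M) j) \o zincl (stab_ker F (I M) j.+1)
  end.

Lemma mono_cocycle x : fmap F (cosyz_mono (I M) i) x \in der_cocycles F (I M) i.
Proof.
apply/kerpP; apply: fmap_zero => a.
by rewrite cosyz_diff cosyz_mono_epi; exact: raddf0.
Qed.
Definition mono_cls : {additive F (cosyz (I M) i) -> derived i M} :=
  zcls (der_cocycles F (I M) i) (der_cobdries F (I M) i) \o zcorestr mono_cocycle.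
End SeqMaps.

Lemma mono_cls_im j (M : lmodType L) x :
  x \in sat_im F (I M) j -> mono_cls j.+1 M x = 0.
Proof.
move=> /impP[y <-]; apply/zcls_eq0/impP; exists y; apply/esym.
by apply: fmap_compE => a; rewrite cosyz_diff.
Qed.

Definition seq_mono (i : nat) (M : lmodType L) : {additive satellite i M -> derived i M} :=
  match i return {additive satellite i M -> derived i M} with
  | 0 => mono_cls 0 M
  | j.+1 => zdesc (@mono_cls_im j M)
  end.

Section SeqEpi.
Variables (i : nat) (M : lmodType L).

Lemma epi_stab_subproof (x : zsub (der_cocycles F (I M) i)) :
  (fmap F (cosyz_epi (I M) i) \o zincl _) x \in stab_ker F (I M) i.+1.
Proof.
apply/kerpP; rewrite /= (fmap_compE (h := diff (I M) i)).
  exact/kerpP/(valP x).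
by move=> a; rewrite cosyz_diff.
Qed.

Lemma epi_stab_cobdry (x : zsub (der_cocycles F (I M) i)) :
  x \in zrestr (der_cocycles F (I M) i) (der_cobdries F (I M) i) ->
  zcorestr epi_stab_subproof x = 0.
Proof.
case: x => x xZ xB; apply: val_inj => /=.
have {xB} : x \in der_cobdries F (I M) i by exact: xB.
case: i x xZ => [|j] x _; first by move/nullpP => ->; rewrite raddf0.
move=> /impP[y <-]; apply: fmap_zero => a.
by rewrite cosyz_diff cosyz_mono_epi.
Qed.

Definition seq_epi : {additive derived i M -> sub_stab i.+1 M} :=
  zdesc epi_stab_cobdry.
End SeqEpi.

Section SeqNatural.
Variables (i : nat) (M N : lmodType L) (f : {linear M -> N}).

Lemma seq_sub_natural x :
  seq_sub i N (fmap (sub_stab i) f x) = fmap (satellite i) f (seq_sub i M x).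
Proof.
case: i x => [|j] x //.
exact/esym/satS_mapE.
Qed.

Lemma mono_cls_natural x :
  mono_cls i N (fmap F (cosyz_map (I M) (I N) f i) x) =
  derived_map i f (mono_cls i M x).
Proof.
rewrite [RHS]derived_mapE; congr (zcls _ _ _); apply: val_inj.
by apply: fmap_sq => a; rewrite res_map_mono.
Qed.

Lemma seq_epi_natural x :
  seq_epi i N (fmap (derived i) f x) = fmap (sub_stab i.+1) f (seq_epi i M x).
Proof.
case: (zcls_surj x) => y <-; rewrite [fmap _ _ _]derived_mapE /seq_epi.
rewrite [LHS]zdescE [in RHS]zdescE; apply: val_inj.
by apply: fmap_sq => a; rewrite cosyz_map_epi.
Qed.
End SeqNatural.

Lemma seq_mono_natural (i : nat) (M N : lmodType L) (f : {linear M -> N}) x :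
  seq_mono i N (fmap (satellite i) f x) = fmap (derived i) f (seq_mono i M x).
Proof.
case: i x => [|j] x; first exact: mono_cls_natural.
case: (zpi_surj x) => y <-; rewrite [fmap _ _ _]satS_mapE [LHS]zdescE.
by rewrite [seq_mono _ _ _]zdescE mono_cls_natural.
Qed.

Definition fund_sub (i : nat) : natTrans (sub_stab i) (satellite i) :=
  NatTrans (@seq_sub_natural i).
Definition fund_mono (i : nat) : natTrans (satellite i) (derived i) :=
  NatTrans (@seq_mono_natural i).
Definition fund_epi (i : nat) : natTrans (derived i) (sub_stab i.+1) :=
  NatTrans (@seq_epi_natural i).

(* Exactness of
     0 -> sub_stab 0 -> F -> R^0 F -> sub_stab 1 -> S^1 F -> R^1 F -> ...
   A sequence of functors is exact when it is exact at every module. *)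
Definition fundamental_exact : Prop :=
  forall M : lmodType L,
  [/\ injective (fund_sub 0 M),
      forall i, exact_at (fund_sub i M) (fund_mono i M),
      forall i, exact_at (fund_mono i M) (fund_epi i M) &
      forall i, exact_at (fund_epi i M) (fund_sub i.+1 M)].

End FundamentalSequence.

(* Ext^i(A, -) is the i-th right derived functor of Hom(A, -). *)
Definition Ext (L : pzRingType)
    (I : forall M : lmodType L, injective_resolution M)
    (i : nat) (A : lmodType L) : addFunctor L :=
  derived I (homF A) i.

(* Main.v *)
(* F = H^n(C, -) is half exact because C_n and C_(n-1) are projective, and this
   is all that exactness of the fundamental sequence needs. Write Q_k = C_k / B_k.
   - On an injective module E, restriction of cocycles to Z_n is an isomorphism
     F(E) = Hom(H_n, E), so F and Hom(H_n, -) have the same right derived functors.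
   - Hom(Q_n, -) -> F is onto with kernel the coboundaries h d_n, and these lift
     along I^j -> Sigma^(j+1) since C_(n-1) is projective; hence S^(j+1) F is
     S^(j+1) Hom(Q_n, -) = Ext^(j+1)(Q_n, -).
   - If f : C_n -> Sigma^i M becomes a coboundary in I^i, say m_i f = h d_n, then
     d^i h kills B_(n-1) and defines a cocycle Q_(n-1) -> I^(i+1).
   The isomorphisms involve choices of representatives, so they are given by
   their graphs (iso_rel). *)

Require Import Defs.
From HB Require Import structures.
From mathcomp Require Import all_boot all_algebra boolp.

Set Implicit Arguments.
Unset Strict Implicit.
Unset Printing Implicit Defensive.

Import GRing.Theory.
Local Open Scope ring_scope.

(** * Factoring, lifting and extending linear maps *)

Section LinearMaps.
Variable L : pzRingType.

(** Preimages under an injective [m] are unique, so the ones chosen pointwise automatically depend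
    linearly on the argument. *)
Lemma linear_factor (A B X : lmodType L) (m : {linear A -> B}) (f : {linear X -> B}) :
  injective m -> (forall x, exists a, m a = f x) ->
  exists g : {linear X -> A}, forall x, m (g x) = f x.
Proof.
move=> m_inj mf; pose g x := projT1 (cid (mf x)).
have gE x : m (g x) = f x by exact: projT2 (cid (mf x)).
have g_lin : linear g by move=> a x y; apply: m_inj; rewrite linearP !gE linearP.
pose gL := GRing.isLinear.Build L X A _ g g_lin.
by exists (HB.pack_for {linear X -> A} g gL).
Qed.

(** Projectivity lifts along surjections only, so [u] and [f] are first corestricted to the image of
    [u]. *)
Lemma linear_lift (P A B : lmodType L) (u : {linear A -> B}) (f : {linear P -> B}) :
  projective_module P -> (forall p, exists a, u a = f p) ->
  exists g : {linear P -> A}, forall p, u (g p) = f p.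
Proof.
move=> projP uf.
have [||u' u'E] := @linear_factor _ _ _ (lincl (lim u)) u.
- exact: val_inj.
- move=> a; have ua : u a \in (lim u : zmodClosed _) by apply/impP; exists a.
  by exists (ZSub ua).
have [||f' f'E] := @linear_factor _ _ _ (lincl (lim u)) f.
- exact: val_inj.
- move=> p; have fp : f p \in (lim u : zmodClosed _) by apply/impP; exact: uf.
  by exists (ZSub fp).
have [|g gE] := projP _ _ u' f'.
  case=> b bu; case/impP: (bu) => a ab; exists a; apply: val_inj.
  exact: etrans (u'E a) ab.
by exists g => p; rewrite -u'E gE f'E.
Qed.

(** Injectivity of [E] extends along injective maps only, so [A] is divided by the kernel of [u];
    the hypothesis makes [f] descend to this quotient. *)
Lemma linear_extend (E A B : lmodType L) (u : {linear A -> B}) (f : {linear A -> E}) :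
  injective_module E -> (forall a, u a = 0 -> f a = 0) ->
  exists g : {linear B -> E}, forall a, g (u a) = f a.
Proof.
move=> injE uf.
have fK a : a \in (Defs.lker u : zmodClosed _) -> f a = 0 by move=> /kerpP /uf.
have uK a : a \in (Defs.lker u : zmodClosed _) -> u a = 0 by move=> /kerpP.
have [|g gE] := injE _ _ (ldesc uK) (ldesc fK).
  move=> p q; case: (lpi_surj p) => x <-; case: (lpi_surj q) => y <-.
  rewrite !ldescE => xy; apply/zpi_eq/kerpP.
  by change (u (x - y) = 0); rewrite linearB xy; exact: subrr.
by exists g => a; rewrite -(ldescE fK) -gE ldescE.
Qed.

Lemma linear_desc (X V W : lmodType L) (u : {linear X -> V}) (f : {linear V -> W}) :
  (forall x, f (u x) = 0) ->
  exists g : {linear lquot (lim u) -> W}, forall v, g (lpi (lim u) v) = f v.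
Proof.
move=> fu; have fN v : v \in (lim u : zmodClosed _) -> f v = 0.
  by move=> /impP[x <-]; exact: fu.
exists (ldesc fN) => v; exact: (ldescE fN).
Qed.

Lemma linear_subE (A B : lmodType L) (f g : {linear A -> B}) x :
  (f - g) x = f x - g x.
Proof. by []. Qed.

Lemma linear_addE (A B : lmodType L) (f g : {linear A -> B}) x :
  (f + g) x = f x + g x.
Proof. by []. Qed.

Lemma lquot_ext (V W : lmodType L) (N : submodule V) (f g : {linear lquot N -> W}) :
  (forall v, f (lpi N v) = g (lpi N v)) -> f = g.
Proof. by move=> fg; apply: linear_ext => q; case: (lpi_surj q) => v <-. Qed.

Lemma lpi_lim (X V : lmodType L) (u : {linear X -> V}) x : lpi (lim u) (u x) = 0.
Proof. by apply/lpi_eq0/impP; exists x. Qed.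
End LinearMaps.

(** * Additive isomorphisms described by their graphs *)

Record iso_rel (X Y : zmodType) (R : X -> Y -> Prop) : Prop := IsoRel {
  irB : forall x y x' y', R x y -> R x' y' -> R (x - x') (y - y');
  irL : forall x, exists y, R x y;
  irR : forall y, exists x, R x y;
  irL0 : forall x, R x 0 -> x = 0;
  irR0 : forall y, R 0 y -> y = 0
}.

Section IsoRel.
Variables (X Y : zmodType) (R : X -> Y -> Prop) (isoR : iso_rel R).

Definition rel_fun of iso_rel R := fun x => projT1 (cid (irL isoR x)).

Lemma rel_funP x : R x (rel_fun isoR x).
Proof. exact: projT2 (cid (irL isoR x)). Qed.

(** [irB] and [irR0] amount to single-valuedness: two values at [x] differ by a value at
    [x - x = 0]. *)
Lemma rel_fun_uniq x y : R x y -> rel_fun isoR x = y.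
Proof.
move=> Rxy; apply/eqP; rewrite -subr_eq0; apply/eqP/(irR0 isoR).
by rewrite -[0](subrr x); apply: irB (rel_funP x) Rxy.
Qed.

Lemma rel_fun_additive : zmod_morphism (rel_fun isoR).
Proof. by move=> x y; apply: rel_fun_uniq; apply: irB => //; exact: rel_funP. Qed.
HB.instance Definition _ :=
  GRing.isZmodMorphism.Build X Y (rel_fun isoR) rel_fun_additive.
Definition rel_map : {additive X -> Y} := rel_fun isoR.

Lemma rel_map_bij : bijective rel_map.
Proof.
pose g y := projT1 (cid (irR isoR y)).
have gP y : R (g y) y by exact: projT2 (cid (irR isoR y)).
exists g => [x|y]; last exact: rel_fun_uniq.
apply/eqP; rewrite -subr_eq0; apply/eqP/(irL0 isoR).
by rewrite -[0](subrr (rel_map x)); apply: irB (gP _) (rel_funP x).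
Qed.
End IsoRel.

(** Both sides of the naturality square are related to the same element, hence equal. *)
Lemma naturally_isomorphic_rel (L : pzRingType) (F G : addFunctor L)
    (R : forall M, F M -> G M -> Prop) :
  (forall M, iso_rel (R M)) ->
  (forall (M N : lmodType L) (f : {linear M -> N}) x y,
    R M x y -> R N (fmap F f x) (fmap G f y)) ->
  naturally_isomorphic F G.
Proof.
move=> isoR natR.
have nat (M N : lmodType L) (f : {linear M -> N}) x :
    rel_map (isoR N) (fmap F f x) = fmap G f (rel_map (isoR M) x).
  by apply: rel_fun_uniq; apply: natR; exact: rel_funP.
by exists (NatTrans nat) => M; exact: rel_map_bij.
Qed.

Lemma naturally_isomorphic_trans (L : pzRingType) (F G H : addFunctor L) :
  naturally_isomorphic F G -> naturally_isomorphic G H -> naturally_isomorphic F H.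
Proof.
move=> [s s_bij] [t t_bij].
have nat (M N : lmodType L) (f : {linear M -> N}) x :
    (t N \o s N) (fmap F f x) = fmap H f ((t M \o s M) x).
  by rewrite /= !naturality.
exists (@NatTrans L F H (fun M => t M \o s M : {additive _ -> _}) nat) => M.
exact: bij_comp.
Qed.

(** * Right derived functors and exactness of the fundamental sequence *)

Definition half_exact (L : pzRingType) (F : addFunctor L) : Prop :=
  forall (A B D : lmodType L) (m : {linear A -> B}) (e : {linear B -> D}),
    injective m -> exact_at m e -> (forall d, exists b, e b = d) ->
    exact_at (fmap F m) (fmap F e).

Section RightFundamental.
Variables (L : pzRingType) (I : forall M : lmodType L, injective_resolution M).

Section DerivedClass.
Variables (F : addFunctor L) (i : nat).

(** Representatives stay plain elements of [F (I M i)]: the cocycle condition is part of the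
    relation, and no representative has to be fixed. *)
Definition der_class (M : lmodType L) (x : derived I F i M) (a : F (I M i)) : Prop :=
  exists aZ : a \in der_cocycles F (I M) i,
    x = zcls (der_cocycles F (I M) i) (der_cobdries F (I M) i) (ZSub aZ).

Variable M : lmodType L.
Implicit Types (x y : derived I F i M) (a b : F (I M i)).

Lemma der_class_ex x : exists a, der_class x a.
Proof. by case: (zcls_surj x) => -[a aZ] <-; exists a, aZ. Qed.

Lemma der_class_mk a : fmap F (diff (I M) i) a = 0 -> exists x, der_class x a.
Proof.
move=> da; have aZ : a \in der_cocycles F (I M) i by apply/kerpP.
by exists (zcls _ _ (ZSub aZ)), aZ.
Qed.

Lemma der_class_cocycle x a : der_class x a -> fmap F (diff (I M) i) a = 0.
Proof. by case=> aZ _; exact/kerpP. Qed.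

Lemma der_classB x y a b :
  der_class x a -> der_class y b -> der_class (x - y) (a - b).
Proof.
move=> [aZ ->] [bZ ->]; exists (rpredB aZ bZ).
by rewrite -raddfB; congr (zcls _ _ _); apply: val_inj.
Qed.

Lemma der_class0 x a : der_class x a -> x = 0 <-> a \in der_cobdries F (I M) i.
Proof. by case=> aZ ->; split=> [/zcls_eq0|?]; [|apply/zcls_eq0]. Qed.
End DerivedClass.

Lemma der_class_map (F : addFunctor L) i (M N : lmodType L) (f : {linear M -> N}) x a :
  der_class x a ->
  der_class (fmap (derived I F i) f x) (fmap F (res_map (I M) (I N) f i) a).
Proof.
case=> aZ ->; exists (der_cocycles_map (I N) f aZ).
by rewrite [LHS]derived_mapE; congr (zcls _ _ _); apply: val_inj.
Qed.

(** Derived functors are computed from values at injective modules. There [R] is an isomorphism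
    compatible with the differentials, so it matches cocycles with cocycles and coboundaries with
    coboundaries. *)
Lemma derived_iso_rel (F G : addFunctor L) (R : forall M, F M -> G M -> Prop) i :
  (forall M x y x' y', R M x y -> R M x' y' -> R M (x - x') (y - y')) ->
  (forall (M N : lmodType L) (f : {linear M -> N}) x y,
    R M x y -> R N (fmap F f x) (fmap G f y)) ->
  (forall M, injective_module M -> iso_rel (R M)) ->
  naturally_isomorphic (derived I F i) (derived I G i).
Proof.
move=> RB Rnat Riso; have isoI M k : iso_rel (R (I M k)) by apply/Riso/res_inj.
apply: (@naturally_isomorphic_rel _ _ _ (fun M x y =>
  exists a b, [/\ der_class x a, der_class y b & R _ a b])); last first.
  move=> M N f x y [a [b [xa yb ab]]].
  exists (fmap F (res_map (I M) (I N) f i) a), (fmap G (res_map (I M) (I N) f i) b).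
  by split; [exact: der_class_map|exact: der_class_map|exact: Rnat].
move=> M; split.
- move=> x y x' y' [a [b [xa yb ab]]] [a' [b' [xa' yb' ab']]].
  by exists (a - a'), (b - b'); split; [exact: der_classB|exact: der_classB|exact: RB].
- move=> x; have [a xa] := der_class_ex x; have [b ab] := irL (isoI M i) a.
  have [|y yb] := @der_class_mk G i M b; last by exists y, a, b.
  (* [R] relates the differential of [a], which is zero, to that of [b], so the latter vanishes. *)
  by apply: (irR0 (isoI M i.+1)); rewrite -(der_class_cocycle xa); exact: Rnat.
- move=> y; have [b yb] := der_class_ex y; have [a ab] := irR (isoI M i) b.
  have [|x xa] := @der_class_mk F i M a; last by exists x, a, b.
  by apply: (irL0 (isoI M i.+1)); rewrite -(der_class_cocycle yb); exact: Rnat.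
- move=> x [a [b [xa yb ab]]]; apply/(der_class0 xa).
  have {yb} := (der_class0 yb).1 erefl.
  case: i a b ab {xa x} => [|j] a b ab.
    by move=> /nullpP b0; apply/nullpP/(irL0 (isoI M 0)); rewrite -b0.
  (* Here [b] is the differential of [b']. Both [a] and the differential of [a'] are related to [b],
     so they agree. *)
  move=> /impP[b' db']; have [a' ab'] := irR (isoI M j) b'.
  apply/impP; exists a'; apply/esym/eqP; rewrite -subr_eq0; apply/eqP.
  apply: (irL0 (isoI M j.+1)); rewrite -[0](subrr b) -{2}db'.
  by apply: RB => //; exact: Rnat.
- move=> y [a [b [xa yb ab]]]; apply/(der_class0 yb).
  have {xa} := (der_class0 xa).1 erefl.
  case: i a b ab {yb y} => [|j] a b ab.
    by move=> /nullpP a0; apply/nullpP/(irR0 (isoI M 0)); rewrite -a0.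
  move=> /impP[a' da']; have [b' ab'] := irL (isoI M j) a'.
  apply/impP; exists b'; apply/esym/eqP; rewrite -subr_eq0; apply/eqP.
  apply: (irR0 (isoI M j.+1)); rewrite -[0](subrr a) -{2}da'.
  by apply: RB => //; exact: Rnat.
Qed.

(** Half exactness on [0 -> Sigma^i M -> I^i -> Sigma^(i+1) M -> 0] gives exactness at [R^i F]. At
    the other terms one unwinds kernels and cokernels, using [d^i = m_(i+1) e_i]. *)
Lemma half_exact_fundamental (F : addFunctor L) :
  half_exact F -> fundamental_exact I F.
Proof.
move=> hF M; split.
- exact: val_inj.
- case=> [|j] y.
    split=> [/zcls_eq0/nullpP y0|[x <-]].
      by have yK : y \in stab_ker F (I M) 0 by [apply/kerpP]; exists (ZSub yK).
    by apply/zcls_eq0/nullpP; exact/kerpP/(valP x).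
  split=> [|[x <-]]; last first.
    rewrite [LHS]zdescE; apply/zcls_eq0/impP; exists 0.
    by rewrite raddf0; exact/esym/kerpP/(valP x).
  case: (zpi_surj y) => z <-; rewrite [X in X = 0]zdescE => /zcls_eq0/impP[w /= dw].
  (* By [dw], [z] and the image of [w] under [F(e_j)] agree after [F(m_(j+1))]. Their difference
     lies in the sub-stabilization and has the same class as [z] in the satellite. *)
  have zK : z - fmap F (cosyz_epi (I M) j) w \in stab_ker F (I M) j.+1.
    apply/kerpP; rewrite raddfB -dw; apply/eqP; rewrite subr_eq0; apply/eqP.
    by apply/esym/fmap_compE => a; rewrite cosyz_diff.
  exists (ZSub zK); apply/zpi_eq; apply/impP; exists (- w) => /=.
  by rewrite raddfN addrAC subrr add0r.
- move=> i y; split=> [|].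
    case: (zcls_surj y) => -[a aZ] <-; rewrite [X in X = 0]zdescE.
    move/(congr1 val) => /= ea.
    have [b bE] := (hF _ _ _ _ _ (@cosyz_mono_inj _ _ (I M) i)
      (@cosyz_exact _ _ (I M) i) (@cosyz_epi_surj _ _ (I M) i) a).1 ea.
    (* The preimage is [b] itself in degree 0, where the satellite is [F], and the class of [b] in
       higher degrees. *)
    case: i y a aZ ea b bE => [|j] y a aZ ea b bE.
      by exists b; congr (zcls _ _ _); apply: val_inj.
    exists (zpi (sat_im F (I M) j) b); rewrite [LHS]zdescE.
    by congr (zcls _ _ _); apply: val_inj.
  have mono_epi0 b : fund_epi I F i M (mono_cls I F i M b) = 0.
    rewrite [LHS]zdescE; apply: val_inj => /=; apply: fmap_zero => a.
    exact: cosyz_mono_epi.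
  case: i y mono_epi0 => [|j] y me0 [x <-]; first exact: me0.
  by case: (zpi_surj x) => b <-; rewrite [fund_mono _ _ _ _ _]zdescE me0.
- move=> i y; split.
    case: y => a aK /zpi_eq0/impP[b ba].
    have bZ : b \in der_cocycles F (I M) i.
      apply/kerpP; rewrite -(fmap_compE (f := cosyz_epi (I M) i)
        (g := cosyz_mono (I M) i.+1)); first by rewrite ba; exact/kerpP.
      by move=> z; rewrite cosyz_diff.
    exists (zcls _ _ (ZSub bZ)); rewrite [LHS]zdescE; exact: val_inj.
  case=> x <-; case: (zcls_surj x) => b <-; rewrite [fund_epi _ _ _ _ _]zdescE.
  by apply/zpi_eq0/impP; exists (val b).
Qed.

Lemma hom_der_cocycle (A M : lmodType L) i (x : Ext I i A M) (g : {linear A -> I M i}) :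
  der_class x g -> forall a, diff (I M) i (g a) = 0.
Proof.
by move=> xg a; have /(congr1 (fun h : {linear A -> _} => h a)) := der_class_cocycle xg.
Qed.

Lemma hom_der_class_mk (A M : lmodType L) i (g : {linear A -> I M i}) :
  (forall a, diff (I M) i (g a) = 0) ->
  exists x : Ext I i A M, der_class x (g : homF A (I M i)).
Proof. by move=> dg; apply: der_class_mk; exact/linear_ext. Qed.

Lemma hom_der_class0 (A M : lmodType L) i (x : Ext I i.+1 A M)
    (g : {linear A -> I M i.+1}) : der_class x g ->
  x = 0 <-> exists k : {linear A -> I M i}, forall a, g a = diff (I M) i (k a).
Proof.
move/der_class0 ->; split=> [/impP[k kg]|[k kg]].
  by exists k => a; rewrite -kg.
by apply/impP; exists k; apply: linear_ext => a; exact/esym/kg.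
Qed.

(** Left exactness of Hom: a map into [I^0] killed by [d^0] factors uniquely through the
    augmentation, and in degree 0 the only coboundary is zero. *)
Lemma derived_homF0 (A : lmodType L) :
  naturally_isomorphic (derived I (homF A) 0) (homF A).
Proof.
apply: (@naturally_isomorphic_rel _ _ (homF A) (fun M x (g : {linear A -> M}) =>
  @der_class (homF A) 0 M x (aug (I M) \o g : {linear A -> I M 0}))); last first.
  move=> M N f x g xg; have := der_class_map f xg.
  congr der_class; apply: linear_ext => a /=.
  exact: (@res_map_mono L M N (I M) (I N) f 0 ((g : {linear A -> M}) a)).
move=> M; split.
- move=> x g x' g' xg xg'; have := der_classB xg xg'.
  by congr der_class; apply: linear_ext => a; exact/esym/(linearB (aug (I M))).
- move=> x; have [f xf] := der_class_ex x.
  have df a : diff (I M) 0 (f a) = 0.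
    by have /(congr1 (fun h : {linear A -> _} => h a)) := der_class_cocycle xf.
  have [|g gE] := linear_factor (@aug_inj _ _ (I M)) (f := f).
    by move=> a; exact: (aug_exact (I M) _).1 (df a).
  exists g; move: xf; congr der_class; apply: linear_ext => a; exact: esym (gE a).
- move=> g; apply: der_class_mk; apply: linear_ext => a.
  by apply: (aug_exact (I M) _).2; exists (g a).
- move=> x x0; apply/(der_class0 x0)/nullpP/linear_ext => a.
  exact: (linear0 (aug (I M))).
- move=> g /der_class0[/(_ erefl)/nullpP g0 _]; apply: linear_ext => a.
  apply: (@aug_inj _ _ (I M)); rewrite [in RHS](linear0 (aug (I M))).
  exact: (congr1 (fun h : {linear A -> _} => h a) g0).
Qed.
End RightFundamental.

(** * Cohomology of a complex of projective modules *)

Section ComplexCohomology.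
Variables (L : pzRingType) (C : chain_complex L) (n : int).
Local Notation F := (cohomology C n).

Definition coh_class (M : lmodType L) (x : F M) (f : {linear C n -> M}) : Prop :=
  exists fZ : f \in cocycles C n M,
    x = zcls (cocycles C n M) (cobdries C n M) (ZSub fZ).

Section OneModule.
Variable M : lmodType L.
Implicit Types (x y : F M) (f g : {linear C n -> M}).

Lemma coh_class_ex x : exists f, coh_class x f.
Proof. by case: (zcls_surj x) => -[f fZ] <-; exists f, fZ. Qed.

Lemma coh_class_mk f :
  (forall c, f (bdry C (n + 1) n c) = 0) -> exists x, coh_class x f.
Proof.
move=> fd; have fZ : f \in cocycles C n M by apply/kerpP/linear_ext/fd.
by exists (zcls _ _ (ZSub fZ)), fZ.
Qed.

Lemma coh_class_cocycle x f :
  coh_class x f -> forall c, f (bdry C (n + 1) n c) = 0.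
Proof.
by case=> fZ _ c; have /kerpP/(congr1 (fun h : {linear C (n + 1) -> M} => h c)) := fZ.
Qed.

Lemma coh_classB x y f g :
  coh_class x f -> coh_class y g -> coh_class (x - y) (f - g).
Proof.
move=> [fZ ->] [gZ ->]; exists (rpredB fZ gZ).
by rewrite -raddfB; congr (zcls _ _ _); apply: val_inj.
Qed.

Lemma coh_class0 x f : coh_class x f ->
  x = 0 <-> exists h : {linear C (n - 1) -> M}, forall c, f c = h (bdry C n (n - 1) c).
Proof.
case=> fZ ->; split=> [/zcls_eq0/impP[h hf]|[h hf]].
  by exists h => c; rewrite -[f]hf.
by apply/zcls_eq0/impP; exists h; apply: linear_ext => c; rewrite /= hf.
Qed.
End OneModule.

Lemma coh_class_map (M N : lmodType L) (k : {linear M -> N}) x f :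
  coh_class x f -> coh_class (fmap F k x) (k \o f : {linear C n -> N}).
Proof.
case=> fZ ->; exists (cocycles_map k fZ).
by rewrite [LHS]cohom_mapE; congr (zcls _ _ _); apply: val_inj.
Qed.

Hypothesis projC : forall k : int, projective_module (C k).

(** If [e f] is a coboundary [h d_n], projectivity of [C_(n-1)] lifts [h] along [e] to [h']. The
    cocycle [f - h' d_n] is cohomologous to [f] and takes its values in the image of [m]. *)
Lemma cohomology_half_exact : half_exact F.
Proof.
move=> A B D m e m_inj me e_surj y; split; last first.
  case=> x <-; have [f xf] := coh_class_ex x.
  apply/(coh_class0 (coh_class_map e (coh_class_map m xf))).
  (* The cochain [e m f] is itself zero, so the zero map bounds it. *)
  by exists 0 => c; apply: (me _).2; exists (f c).
have [f yf] := coh_class_ex y => y0.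
have [h hE] := (coh_class0 (coh_class_map e yf)).1 y0.
have [h' h'E] := linear_lift (f := h) (@projC _) (fun c => e_surj (h c)).
have [|g gE] := linear_factor m_inj
    (f := f - (h' \o bdry C n (n - 1) : {linear C n -> B}) : {linear C n -> B}).
  move=> c; apply: (me _).1.
  by rewrite [LHS](linearB e (f c) (h' _)) h'E -hE; exact: subrr.
have [|x xg] := @coh_class_mk A g.
  move=> c; apply: m_inj; rewrite gE [RHS](linear0 m).
  rewrite linear_subE /= (coh_class_cocycle yf) bdry_bdry.
  by rewrite (linear0 h'); exact: subrr.
exists x; apply/eqP; rewrite -subr_eq0; apply/eqP.
apply/(coh_class0 (coh_classB (coh_class_map m xg) yf)); exists (- h') => c.
by rewrite linear_subE /= gE linear_subE /= addrAC subrr add0r.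
Qed.

(** The graph of the evaluation map [H^n(C, M) -> Hom(H_n(C), M)] of the universal coefficient
    theorem. *)
Definition coh_restr (M : lmodType L) (x : F M) (g : homF (homology C n) M) : Prop :=
  exists2 f, coh_class x f &
    forall z : lsub (Defs.lker (bdry C n (n - 1))),
      f (val z) = (g : {linear homology C n -> M})
        (lpi (lrestr (Defs.lker (bdry C n (n - 1))) (lim (bdry C (n + 1) n))) z).

Lemma coh_restrB M x y x' y' :
  @coh_restr M x y -> coh_restr x' y' -> coh_restr (x - x') (y - y').
Proof.
move=> [f xf fy] [f' xf' fy']; exists (f - f'); first exact: coh_classB.
by move=> z; rewrite linear_subE /= fy fy'.
Qed.

Lemma coh_restr_map (M N : lmodType L) (k : {linear M -> N}) x y :
  coh_restr x y -> coh_restr (fmap F k x) (fmap (homF (homology C n)) k y).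
Proof.
move=> [f xf fy]; exists (k \o f); first exact: coh_class_map.
by move=> z; rewrite /= fy.
Qed.

(** Surjectivity extends a map on the cycles to [C_n]. For injectivity, a cocycle vanishing on
    [Ker d_n] extends along [d_n] to [C_(n-1)], so it is a coboundary. *)
Lemma coh_restr_iso (M : lmodType L) : injective_module M -> iso_rel (@coh_restr M).
Proof.
move=> injM; split.
- by move=> *; exact: coh_restrB.
- move=> x; have [f xf] := coh_class_ex x.
  have fN z : z \in (lrestr (Defs.lker (bdry C n (n - 1)))
      (lim (bdry C (n + 1) n)) : zmodClosed _) -> (f \o lincl _) z = 0.
    move=> zN; have /impP[c cz] : val z \in (lim (bdry C (n + 1) n) : zmodClosed _).
      exact: zN.
    by rewrite /= -[X in f X]cz (coh_class_cocycle xf).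
  exists (ldesc fN), f => // z; exact/esym/(ldescE fN).
- move=> g.
  have [|f fE] := @linear_extend _ M _ _ (lincl (Defs.lker (bdry C n (n - 1))))
    ((g : {linear homology C n -> M}) \o lpi _) injM.
    by move=> a a0; rewrite /= (_ : a = 0) ?linear0 //; exact: val_inj.
  have [|x xf] := @coh_class_mk M f; last by exists x, f.
  move=> c; have cK : bdry C (n + 1) n c \in
      (Defs.lker (bdry C n (n - 1)) : zmodClosed _) by apply/kerpP/bdry_bdry.
  rewrite [LHS](fE (ZSub cK)) /=.
  rewrite (_ : lpi _ _ = 0) ?linear0 //; apply/lpi_eq0.
  by apply/impP; exists c.
- move=> x [f xf f0]; apply/(coh_class0 xf).
  have [|h hE] := @linear_extend _ M _ _ (bdry C n (n - 1)) f injM.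
    move=> c c0; have cK : c \in (Defs.lker (bdry C n (n - 1)) : zmodClosed _).
      exact/kerpP.
    exact: (f0 (ZSub cK)).
  by exists h => c; rewrite hE.
- move=> g [f xf fg]; have [h hE] := (coh_class0 xf).1 erefl.
  apply: lquot_ext => -[z zK]; rewrite -fg hE /=.
  by move/kerpP: (zK) => ->; exact: linear0.
Qed.

(** * Identification of the terms of the sequence with Ext functors *)

Variable I : forall M : lmodType L, injective_resolution M.

Lemma derived_cohomology i :
  naturally_isomorphic (derived I F i) (Ext I i (homology C n)).
Proof.
apply: (@derived_iso_rel _ _ _ _ coh_restr).
- exact: coh_restrB.
- exact: coh_restr_map.
- exact: coh_restr_iso.
Qed.

(** A cocycle [f] with values in [Sigma^(j+1) M] kills [B_n], so [m_(j+1) f] descends to a map [g]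
    on [C_n / B_n]. As [Sigma^(j+1) M] is the kernel of [d^(j+1)], every cocycle [g] arises in this
    way. *)
Lemma satellite_cohomology j :
  naturally_isomorphic (satS I F j) (Ext I j.+1 (chain_mod_bdry C n)).
Proof.
pose p := lpi (lim (bdry C (n + 1) n)).
apply: (@naturally_isomorphic_rel _ (satS I F j)
  (Ext I j.+1 (chain_mod_bdry C n)) (fun M x y =>
  exists u (f : {linear C n -> cosyz (I M) j.+1})
    (g : {linear chain_mod_bdry C n -> I M j.+1}),
  [/\ x = zpi (sat_im F (I M) j) u, coh_class u f, der_class y g &
    forall c, g (p c) = cosyz_mono (I M) j.+1 (f c)])); last first.
  move=> M N k x y [u [f [g [-> uf yg gf]]]].
  exists (fmap F (cosyz_map (I M) (I N) k j.+1) u), (cosyz_map (I M) (I N) k j.+1 \o f).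
  exists (res_map (I M) (I N) k j.+1 \o g); split.
  - exact: satS_mapE.
  - exact: coh_class_map.
  - exact: der_class_map.
  - move=> c; apply: etrans (congr1 (res_map (I M) (I N) k j.+1) (gf c)) _.
    exact: (@res_map_mono _ _ _ (I M) (I N) k j.+1).
move=> M; have m_inj := @cosyz_mono_inj _ _ (I M) j.+1; split.
- move=> x y x' y' [u [f [g [-> uf yg gf]]]] [u' [f' [g' [-> uf' yg' gf']]]].
  exists (u - u'), (f - f'), (g - g'); split.
  - by rewrite raddfB.
  - exact: coh_classB.
  - exact: der_classB.
  - move=> c; rewrite linear_subE /= gf gf'.
    exact/esym/(linearB (cosyz_mono (I M) j.+1)).
- move=> x; have [u ux] := zpi_surj x; have [f uf] := coh_class_ex u.
  have [|g gE] := @linear_desc _ _ _ _ (bdry C (n + 1) n) (cosyz_mono (I M) j.+1 \o f).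
    move=> c; rewrite /= (coh_class_cocycle uf).
    exact: (linear0 (cosyz_mono (I M) j.+1)).
  have [|y yg] := hom_der_class_mk (g := g).
    move=> q; have [c <-] := lpi_surj q; rewrite gE.
    by rewrite cosyz_diff /= cosyz_mono_epi; exact: (linear0 (cosyz_mono (I M) j.+2)).
  by exists y, u, f, g.
- move=> y; have [g yg] := der_class_ex y.
  have [|f fE] := linear_factor m_inj (f := (g : {linear _ -> _}) \o p).
    move=> c; apply: (cosyz_exact _).1; apply: (@cosyz_mono_inj _ _ (I M) j.+2).
    rewrite -cosyz_diff [LHS](hom_der_cocycle yg).
    exact/esym/(linear0 (cosyz_mono (I M) j.+2)).
  have [|u uf] := @coh_class_mk _ f.
    move=> c; apply: m_inj; rewrite fE /= lpi_lim.
    rewrite (linear0 (g : {linear _ -> _})).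
    exact/esym/(linear0 (cosyz_mono (I M) j.+1)).
  by exists (zpi _ u), u, f, g; split=> // c; exact/esym/fE.
- move=> x [u [f [g [-> uf yg gf]]]].
  have [k gk] := (hom_der_class0 yg).1 erefl.
  (* From [g = d^j k] follows [f = e_j k p], an equality of cochains, so the class of [k p] maps to
     [u] and the bounding map is zero. *)
  have [|w wk] := @coh_class_mk _ (k \o p).
    by move=> c; rewrite /= lpi_lim; exact: linear0.
  apply/zpi_eq0/impP; exists w; apply/eqP; rewrite -subr_eq0; apply/eqP.
  apply/(coh_class0 (coh_classB (coh_class_map _ wk) uf)); exists 0 => c.
  apply/eqP; rewrite subr_eq0; apply/eqP; apply: m_inj.
  by rewrite -gf gk cosyz_diff.
- move=> y [u [f [g [/esym/zpi_eq0/impP[w wu] uf yg gf]]]].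
  have [f' wf'] := coh_class_ex w.
  have := coh_classB uf (coh_class_map (cosyz_epi (I M) j) wf').
  move/coh_class0; rewrite wu => -[/(_ (subrr u))[h hE] _].
  (* Now [f - e_j f' = h d_n]. With [h] lifted along [e_j], the map [f' + h' d_n] still kills [B_n],
     and [e_j] sends it to [f]; it descends to the cochain [k] bounding [g]. *)
  have [h' h'E] := linear_lift (f := h) (@projC _) (fun c => cosyz_epi_surj (h c)).
  have [|k kE] := @linear_desc _ _ _ _ (bdry C (n + 1) n)
      (f' + (h' \o bdry C n (n - 1) : {linear C n -> _}) : {linear C n -> _}).
    move=> c; rewrite linear_addE /= (coh_class_cocycle wf') bdry_bdry.
    by rewrite (linear0 h') addr0.
  apply/(hom_der_class0 yg); exists k => q; have [c <-] := lpi_surj q.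
  rewrite [LHS]gf [X in diff _ _ X]kE cosyz_diff; congr (cosyz_mono _ _ _).
  rewrite linear_addE linearD /= h'E -hE.
  by rewrite linear_subE /= subrKC.
Qed.

(** The class of [g] is independent of the choices: [h] is determined by [f] up to maps factoring
    through [p], which change [g] by a coboundary, and adding [h' d_n] to [f] adds [m_i h'] to [h],
    which [d^i] kills. *)
Lemma sub_stab_cohomology i :
  naturally_isomorphic (sub_stab I F i) (Ext I i.+1 (chain_mod_bdry C (n - 1))).
Proof.
pose d := bdry C n (n - 1); pose p := lpi (lim (bdry C (n - 1 + 1) (n - 1))).
(* The quotient is formed with the boundary from degree [n - 1 + 1], while [d] starts in degree [n];
   [p_desc] and [p_d] bridge the two indices. *)
have p_desc (W : lmodType L) (f : {linear C (n - 1) -> W}) :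
    (forall c, f (d c) = 0) ->
    exists g : {linear chain_mod_bdry C (n - 1) -> W}, forall c, g (p c) = f c.
  by move=> fd; apply: linear_desc; rewrite subrK.
have p_d c : p (d c) = 0.
  have ex k : k = n -> exists x, bdry C k (n - 1) x = d c by move=> ->; exists c.
  by apply/lpi_eq0/impP/ex; rewrite subrK.
apply: (@naturally_isomorphic_rel _ (sub_stab I F i)
  (Ext I i.+1 (chain_mod_bdry C (n - 1))) (fun M x y =>
  exists (h : {linear C (n - 1) -> I M i}) (f : {linear C n -> cosyz (I M) i})
    (g : {linear chain_mod_bdry C (n - 1) -> I M i.+1}),
  [/\ coh_class (val x) f, der_class y g,
    forall c, cosyz_mono (I M) i (f c) = h (d c) &
    forall c, g (p c) = diff (I M) i (h c)])); last first.
  move=> M N k x y [h [f [g [xf yg fh gh]]]].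
  exists (res_map (I M) (I N) k i \o h), (cosyz_map (I M) (I N) k i \o f).
  exists (res_map (I M) (I N) k i.+1 \o g); split.
  - exact: coh_class_map.
  - exact: der_class_map.
  - by move=> c; rewrite /= -fh res_map_mono.
  - by move=> c; rewrite /= -res_map_diff -gh.
move=> M; have m_inj := @cosyz_mono_inj _ _ (I M) i; split.
- move=> x y x' y' [h [f [g [xf yg fh gh]]]] [h' [f' [g' [xf' yg' fh' gh']]]].
  exists (h - h'), (f - f'), (g - g'); split.
  - exact: coh_classB.
  - exact: der_classB.
  - move=> c; rewrite linear_subE /= -fh -fh'.
    exact: (linearB (cosyz_mono (I M) i)).
  - move=> c; rewrite linear_subE /= gh gh'.
    exact/esym/(linearB (diff (I M) i)).
- case=> x xK; have [f xf] := coh_class_ex x.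
  have [h hE] := (coh_class0 (coh_class_map (cosyz_mono (I M) i) xf)).1 (kerpP _ _ xK).
  have [|g gE] := p_desc _ (diff (I M) i \o h).
    move=> c; rewrite /= -hE cosyz_diff /= cosyz_mono_epi.
    exact: (linear0 (cosyz_mono (I M) i.+1)).
  have [|y yg] := hom_der_class_mk (g := g).
    move=> q; have [c <-] := lpi_surj q; rewrite gE.
    by apply: (diff_exact (I M) _ _).2; exists (h c).
  by exists y, h, f, g.
- move=> y; have [g yg] := der_class_ex y.
  (* The map [g p] lands in the kernel of [d^(i+1)], which is the image of [d^i], so projectivity of
     [C_(n-1)] provides [h]. Then [d^i h d = g p d = 0], so [h d] factors through [m_i]. *)
  have [|h hE] := linear_lift (u := diff (I M) i) (f := (g : {linear _ -> _}) \o p)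
    (@projC _).
    by move=> c; apply: (diff_exact (I M) i _).1; exact: hom_der_cocycle yg _.
  have [|f fE] := linear_factor m_inj (f := h \o d).
    move=> c; apply: (cosyz_exact _).1; apply: (@cosyz_mono_inj _ _ (I M) i.+1).
    rewrite -cosyz_diff hE /= p_d (linear0 (g : {linear _ -> _})).
    exact/esym/(linear0 (cosyz_mono (I M) i.+1)).
  have [|x xf] := @coh_class_mk _ f.
    move=> c; apply: m_inj; rewrite fE /= [d _]bdry_bdry (linear0 h).
    exact/esym/(linear0 (cosyz_mono (I M) i)).
  have xK : x \in stab_ker F (I M) i.
    by apply/kerpP/(coh_class0 (coh_class_map _ xf)); exists h.
  by exists (ZSub xK), h, f, g; split=> // c; exact/esym/hE.
- move=> x [h [f [g [xf yg fh gh]]]]; apply: val_inj; apply/(coh_class0 xf).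
  have [k gk] := (hom_der_class0 yg).1 erefl.
  (* Since [g = d^i k], the map [h - k p] is killed by [d^i] and equals some [m_i h']; composing
     with [d] gives [f = h' d]. *)
  have [|h' h'E] := linear_factor m_inj
      (f := h - ((k : {linear _ -> _}) \o p : {linear C (n - 1) -> _})
      : {linear C (n - 1) -> _}).
    move=> c; apply: (cosyz_exact _).1; apply: (@cosyz_mono_inj _ _ (I M) i.+1).
    rewrite -cosyz_diff linear_subE /= linearB -gh gk.
    by rewrite (linear0 (cosyz_mono (I M) i.+1)); exact: subrr.
  exists h' => c; apply: m_inj; rewrite fh h'E.
  by rewrite linear_subE /= p_d (linear0 k) subr0.
- move=> y [h [f [g [xf yg fh gh]]]]; have [h' fE] := (coh_class0 xf).1 erefl.
  (* With [f = h' d], the map [h - m_i h'] kills the boundaries, and its descent [k] satisfies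
     [g = d^i k]. *)
  have [|k kE] := p_desc _ (h - (cosyz_mono (I M) i \o h' : {linear C (n - 1) -> _})
      : {linear C (n - 1) -> _}).
    move=> c; rewrite linear_subE /= -fh fE; exact: subrr.
  apply/(hom_der_class0 yg); exists k => q; have [c <-] := lpi_surj q.
  rewrite [LHS]gh [X in _ = diff _ _ X]kE linear_subE /=.
  rewrite linearB [X in _ = _ - X]cosyz_diff cosyz_mono_epi.
  by rewrite (linear0 (cosyz_mono (I M) i.+1)) subr0.
Qed.
End ComplexCohomology.

Theorem mainTheorem6 (Lambda : pzRingType)
    (I : forall M : lmodType Lambda, injective_resolution M)
    (C : chain_complex Lambda)
    (projC : forall k : int, projective_module (C k))
    (n : int) :
  let F := cohomology C n in
  [/\ fundamental_exact I F,
      forall i : nat, naturally_isomorphic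
        (sub_stab I F i) (Ext I i.+1 (chain_mod_bdry C (n - 1))),
      naturally_isomorphic (derived I F 0) (homF (homology C n)),
      forall i : nat, naturally_isomorphic
        (derived I F i) (Ext I i (homology C n)) &
      forall i : nat, (1 <= i)%N -> naturally_isomorphic
        (satellite I F i) (Ext I i (chain_mod_bdry C n))].
Proof.
split.
- exact/half_exact_fundamental/cohomology_half_exact.
- exact: sub_stab_cohomology.
- exact: naturally_isomorphic_trans (derived_cohomology _ _ _ 0) (derived_homF0 _ _).
- exact: derived_cohomology.
- by case=> // j _; exact: satellite_cohomology.
Qed.
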